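(* Let $k\ge 3$ be an integer and let $n\in\mathbb{N}$ with $n<2^k$. Then $b_{2^k-1}(n)$ is not a sum of three squares of integers if and only if one of the following cases holds: (1) $0\le n<2^{k-2}$ and $t_n=-1$; (2) $2^{k-1}\le n<3\cdot 2^{k-2}$ and $t_n=1$.
   Context: $\mathbb{N}$ is the set of non-negative integers. For a positive integer $m$, $b_m(n)$ is the number of partitions of $n$ into powers of two where each part has one of $m$ colors, i.e. $\sum_{n\ge 0} b_m(n)x^n=\prod_{j\ge 0}(1-x^{2^j})^{-m}$. An integer $N$ is a sum of three squares if $N=x^2+y^2+z^2$ for some $x,y,z\in\mathbb{Z}$ (zero allowed). The Prouhet-Thue-Morse sequence is $t_n=(-1)^{s_2(n)}$, where $s_2(n)$ is the number of digits $1$ in the binary expansion of $n$. *)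

(* Defs.v *)
From HB Require Import structures.
From mathcomp Require Import all_boot all_order all_algebra.

Set Implicit Arguments.
Unset Strict Implicit.
Unset Printing Implicit Defensive.

Import GRing.Theory.
Local Open Scope ring_scope.

(* A partition of n into powers of two coloured with m colours is given by its
   multiplicities: f (j, c) is the number of parts 2 ^ j of colour c.  The
   bounds j <= n and f (j, c) <= n lose nothing, because a part 2 ^ j of a
   partition of n satisfies j < 2 ^ j <= n, and a partition of n has at most n
   parts. *)
Definition colored_binary_partitions (m n : nat) :
    {set {ffun 'I_n.+1 * 'I_m -> 'I_n.+1}} :=
  [set f : {ffun 'I_n.+1 * 'I_m -> 'I_n.+1} |
     (\sum_(p : 'I_n.+1 * 'I_m) f p * 2 ^ p.1)%N == n].

Definition b (m n : nat) : nat := #|colored_binary_partitions m n|.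

Definition sum_of_three_squares (N : int) : Prop :=
  exists x y z : int, N = x ^+ 2 + y ^+ 2 + z ^+ 2.

(* The digits of index i >= n of n vanish, since n < 2 ^ n. *)
Definition s2 (n : nat) : nat := (\sum_(i < n) (n %/ 2 ^ i) %% 2)%N.

(* Prouhet-Thue-Morse *)
Definition t (n : nat) : int := (-1) ^+ s2 n.

(* Main.v *)
Require Import Defs.
From mathcomp Require Import all_boot all_order all_algebra.
From mathcomp Require Import zify ring.

(** Let T be the Thue-Morse series, the product of the 1 - X^(2^j).  The series
    of b_m is T^(-m), and 1/T = 1 - X mod 2, so that T^(-2^k) = (1 - X^q)^4 mod 8
    for q = 2^(k-2).  Hence b_(2^k-1)(n) is mod 8 the coefficient of X^n in
    T * (1 - X^q)^4; it is odd, and the two cases are those where it is 7 mod 8.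

    What remains is the three squares theorem for N = 3 mod 8 and N = 1 mod 4,
    which is proved without primes in progressions, by showing that N has exactly
    - 4 times as many representations x^2 + y^2 + z^2 (x, y, z odd) as
      4pq - b^2 (p, q, b odd, p, q > 0, |b| < 2p, |b| < 2q) if N = 3 mod 8,
    - 2 times as many representations x^2 + y^2 + z^2 (x odd, y, z even) as
      pq - c^2 (p, q odd and positive, c even, |c| < p, |c| < q) if N = 1 mod 4;
    representations of the second kind exist, with p = 1.  By induction on N, it
    is enough to compare the sums of both counts over all L - x^2, x odd, for a
    fixed L.  Both sums are multiples of the divisor sum of an odd number M.

    For the squares, this is Jacobi's formula for four odd squares: both sides
    satisfy the recurrence sum_x (L - 5 x^2) f(L - x^2) = 0.  For the forms, a
    form together with x is an integer matrix, on which the reflections in the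
    sides of an ideal quadrilateral act from the left.  The graph of this action
    is oriented in two ways, with at most one edge leaving each vertex: the sinks
    of the first orientation are the matrices of reduced forms, those of the
    second one are Hermite-like normal forms, which are counted directly.  A box
    that is closed under both orientations has as many sinks for one as for the
    other, since vertices minus sinks are always in bijection with edges. *)

Import Order.TTheory GRing.Theory Num.Theory.
Local Open Scope ring_scope.

(** * Counting in lists and in boxes *)

Lemma leq_count_inj (T U : eqType) (s1 : seq T) (s2 : seq U) (P : pred T) (Q : pred U)
  (h : T -> U) :
  uniq s1 ->
  (forall x, x \in s1 -> P x -> (h x \in s2) && Q (h x)) ->
  (forall x y, x \in s1 -> y \in s1 -> P x -> P y -> h x = h y -> x = y) ->
  (count P s1 <= count Q s2)%N.
Proof.
move=> us hs hinj; rewrite -!size_filter -(size_map h).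
apply: uniq_leq_size => [|y /mapP [x + ->]].
  rewrite map_inj_in_uniq ?filter_uniq // => x y.
  by rewrite !mem_filter => /andP [Px xs] /andP [Py ys]; apply: hinj.
by rewrite !mem_filter => /andP [Px xs]; rewrite andbC hs.
Qed.

Lemma count_bij (T U : eqType) (s1 : seq T) (s2 : seq U) (P : pred T) (Q : pred U)
    (h : T -> U) (h' : U -> T) :
  uniq s1 -> uniq s2 ->
  (forall x, x \in s1 -> P x -> [/\ h x \in s2, Q (h x) & h' (h x) = x]) ->
  (forall y, y \in s2 -> Q y -> [/\ h' y \in s1, P (h' y) & h (h' y) = y]) ->
  count P s1 = count Q s2.
Proof.
move=> u1 u2 H1 H2; apply/eqP; rewrite eqn_leq; apply/andP; split.
  apply: (leq_count_inj _ _ _ _ _ _ h) => // [x xs Px|x y xs ys Px Py E].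
    by have [-> ->] := H1 x xs Px.
  by have [_ _ <-] := H1 x xs Px; rewrite E; have [] := H1 y ys Py.
apply: (leq_count_inj _ _ _ _ _ _ h') => // [x xs Px|x y xs ys Px Py E].
  by have [-> ->] := H2 x xs Px.
by have [_ _ <-] := H2 x xs Px; rewrite E; have [] := H2 y ys Py.
Qed.

(** An orientation of the graph that joins v to [flip j v]: [out j v] says that the edge j leaves v.
    The clauses say that [Z] is closed along it, that an edge has one source, and that a vertex has
    at most one exit. *)
Definition is_flow {T : eqType} {J : finType} (Z : seq T) (flip : J -> T -> T)
  (out : J -> T -> bool) :=
  [/\ forall j v, v \in Z -> out j v -> flip j v \in Z,
      forall j v, v \in Z -> flip j v \in Z -> out j (flip j v) = ~~ out j v
    & forall i j v, v \in Z -> out i v -> out j v -> i = j].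

Definition is_sink {T : eqType} {J : finType} (out : J -> T -> bool) v := [forall j, ~~ out j v].

(** A vertex that is not a sink is the source of exactly one edge. The counts are doubled because
    the sum sees each edge from both ends; that sum does not involve [out], so two orientations can
    be compared. *)
Lemma count_sinks (T : eqType) (J : finType) (Z : seq T) (flip : J -> T -> T)
  (out : J -> T -> bool) :
  uniq Z -> (forall j v, v \in Z -> flip j (flip j v) = v) -> is_flow Z flip out ->
  ((count (is_sink out) Z).*2 + \sum_j count (fun v => flip j v \in Z) Z = (size Z).*2)%N.
Proof.
move=> uZ flipK [outZ outN outI].
have -> : (\sum_j count (fun v => flip j v \in Z) Z = (\sum_j count (out j) Z).*2)%N.
  rewrite -muln2 big_distrl /=; apply: eq_bigr => j _; rewrite muln2 -addnn.
  (* The edges are counted at their targets instead of their sources. *)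
  have {2}-> : count (out j) Z = count (fun v => (flip j v \in Z) && ~~ out j v) Z.
    apply: (count_bij _ _ _ _ _ _ (flip j) (flip j)) => // v vZ.
      by move=> o; have mZ := outZ j v vZ o; rewrite mZ flipK // vZ (outN _ _ vZ mZ) o.
    by case/andP=> mZ o; rewrite mZ (outN _ _ vZ mZ) o flipK.
  rewrite -count_predUI; rewrite [X in (_ + X)%N](_ : _ = 0)%N ?addn0; last first.
    by apply/eqP; rewrite -leqn0 leqNgt -has_count; apply/hasPn => v _ /=; case: (out j v);
      rewrite ?andbF.
  by apply: eq_in_count => v vZ /=; have := outZ j v vZ; case: (out j v) => /= [->|_];
    rewrite ?andbT.
rewrite -doubleD; congr (_.*2).
have -> : (\sum_j count (out j) Z = \sum_(v <- Z) \sum_j out j v)%N.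
  by rewrite exchange_big; apply: eq_bigr => j _; rewrite -sum1_count big_mkcond;
    apply: eq_bigr => v _; case: (out j v).
rewrite -sum1_count big_mkcond -big_split /= -sum1_size !big_seq; apply: eq_bigr => v vZ.
rewrite /is_sink; case: forallP => [nout|/forallP].
  by rewrite big1 // => j _; rewrite (negbTE (nout j)).
rewrite negb_forall => /existsP [j]; rewrite negbK => oj.
rewrite (bigD1 j) //= oj big1 // => i ij; case E: (out i v) => //.
by rewrite (outI i j v vZ E oj) eqxx in ij.
Qed.

Lemma count_sinks_eq (T : eqType) (J : finType) (Z : seq T) (flip : J -> T -> T)
    (o1 o2 : J -> T -> bool) :
  uniq Z -> (forall j v, v \in Z -> flip j (flip j v) = v) ->
  is_flow Z flip o1 -> is_flow Z flip o2 ->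
  count (is_sink o1) Z = count (is_sink o2) Z.
Proof.
move=> uZ flipK f1 f2; apply: double_inj.
by apply/eqP; rewrite -(eqn_add2r (\sum_j count (fun v => flip j v \in Z) Z)) !count_sinks.
Qed.

(* R is a cut-off: what is counted below does not depend on it once it is large. *)
Definition irange (R : nat) : seq int := [seq i%:Z - R%:Z | i <- iota 0 R.*2.+1].

Lemma mem_irange R x : (x \in irange R) = (`|x| <= R%:Z).
Proof.
apply/mapP/idP => [[i]|xR]; first by rewrite mem_iota => ? ->; lia.
by exists (absz (x + R%:Z)); rewrite ?mem_iota; lia.
Qed.

Lemma irange_uniq R : uniq (irange R).
Proof. by rewrite map_inj_uniq ?iota_uniq // => i j /eqP; lia. Qed.

Definition box {T : Type} (r : seq T) (R : nat) : seq (T * int) :=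
  [seq (u, x) | u <- r, x <- irange R].

Lemma mem_box (T : eqType) (r : seq T) R u x : ((u, x) \in box r R) = (u \in r) && (`|x| <= R%:Z).
Proof.
rewrite -mem_irange; apply/allpairsP/andP => [[[a b] /= [? ? [-> ->]]] //|[? ?]].
by exists (u, x).
Qed.

Lemma box_uniq (T : eqType) (r : seq T) R : uniq r -> uniq (box r R).
Proof. by move=> ur; rewrite allpairs_uniq ?irange_uniq // => -[a b] [c d]. Qed.

Arguments irange R : simpl never.
Arguments box {T} r R : simpl never.

(** * Two orientations of a graph of reflections *)

(* (p, s, t, q) is the matrix with rows (p, s) and (t, q). *)
Definition state : Type := (int * int * int * int)%type.

Definition det (v : state) : int := let: (p, s, t, q) := v in p * q - s * t.

Definition sign_of (b : bool) : int := if b then -1 else 1.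

(** On the slope z = s / p of the first row these are z -> - z - 2e and its conjugate by z -> 1 / z:
    the reflections in the sides of the ideal quadrilateral with vertices -1, 0, 1 and infinity. *)
Definition flip (j : bool * bool) (v : state) : state :=
  let: (p, s, t, q) := v in let e := sign_of j.2 in
  if j.1 then (- p - 2 * e * s, s, - t - 2 * e * q, q)
  else (p, - s - 2 * e * p, t, - q - 2 * e * t).

(* The form with coefficients p, s + t, q takes the values p and p + q + (s + t) at
   the ends of the side, which [flip] fixes.  A flip exchanges 2 * p + (s + t) and
   - (s - t), and it negates the value at the second end only: so exactly one of
   the two matrices joined by an edge exits through it. *)
Definition exits (p s t q : int) : bool :=
  ((p < 0) == (p + q + (s + t) < 0)) && ((p < 0) != (2 * p + (s + t) < 0))
  || ((p < 0) != (p + q + (s + t) < 0)) && ((p < 0) != (s - t < 0)).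

Definition reduction_flow (j : bool * bool) (v : state) : bool :=
  let: (p, s, t, q) := v in let e := sign_of j.2 in
  if j.1 then exits q (e * t) (e * s) p else exits p (e * s) (e * t) q.

(** Euclid's algorithm on the first row, with even quotients: the larger of p and s shrinks. In a
    tie p = - e s or s = - e p the flip fixes the first row, and the signs and sizes in the second
    row decide. *)
Definition euclid_flow (j : bool * bool) (v : state) : bool :=
  let: (p, s, t, q) := v in let e := sign_of j.2 in
  if j.1 then
    (`|s| < `|p|) && ((p < 0) != (e * s < 0))
    || (p == - e * s) && ((0 <= t) && (0 < - e * q) && (- e * q < t) || (- e * q < 0)
      && (t < - e * q))
  else
    (`|p| < `|s|) && ((p < 0) != (e * s < 0))
    || (s == - e * p) && ((0 <= t) && (t < - e * q) || (t < 0) && (- e * q < t)).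

(* All the quantities whose signs are compared by the flows. *)
Definition nondeg (v : state) : bool :=
  let: (p, s, t, q) := v in
  [&& p != 0, s != 0, q != 0, s - t != 0 &
   [&& p + q + s + t != 0, p + q - s - t != 0, 2 * p + s + t != 0,
    2 * p - s - t != 0, 2 * q + s + t != 0 & 2 * q - s - t != 0]].

(** What both flows need from a class of matrices. Each flip negates the determinant, hence the two
    signs of K. *)
Definition admissible (D : pred state) (K : nat) :=
  forall v, D v -> [/\ nondeg v, (det v == K%:Z) || (det v == - K%:Z) & forall j, D (flip j v)].

Lemma det_flip j v : det (flip j v) = - det v.
Proof. by case: v => [[[p s] t] q]; case: j => [[] []] /=; ring. Qed.

Lemma flipK j : involutive (flip j).
Proof.
by case=> [[[p s] t] q]; case: j => [[] []] /=; repeat congr pair; ring.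
Qed.

Definition states (D : pred state) R := [seq v <- box (box (box (irange R) R) R) R | D v].

Lemma mem_states D R p s t q :
  ((p, s, t, q) \in states D R) =
  [&& D (p, s, t, q), `|p| <= R%:Z, `|s| <= R%:Z, `|t| <= R%:Z & `|q| <= R%:Z].
Proof. by rewrite mem_filter !mem_box mem_irange -!andbA. Qed.

Lemma states_uniq D R : uniq (states D R).
Proof. by rewrite filter_uniq // !box_uniq // irange_uniq. Qed.

(** * Each edge has one source, and each matrix at most one exit *)

Lemma exits_flip (p s t q : int) :
  p != 0 -> s - t != 0 -> p + q + s + t != 0 -> 2 * p + s + t != 0 ->
  exits p (- s - 2 * p) t (- q - 2 * t) = ~~ exits p s t q.
Proof.
move=> p0 y0 n0 a0; rewrite /exits.
have -> : (p + (- q - 2 * t) + (- s - 2 * p + t) < 0) = ~~ (p + q + (s + t) < 0) by lia.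
have -> : (2 * p + (- s - 2 * p + t) < 0) = ~~ (s - t < 0) by lia.
have -> : (- s - 2 * p - t < 0) = ~~ (2 * p + (s + t) < 0) by lia.
by do !case: (_ < 0).
Qed.

Lemma reduction_flow_flip D K j v : admissible D K -> D v ->
  reduction_flow j (flip j v) = ~~ reduction_flow j v.
Proof.
move=> ad Dv; have [+ _ _] := ad v Dv.
case: v {Dv} => [[[p s] t] q] /= /and5P [? ? ? ? /and5P[? ? ? ? /andP [? ?]]].
case: j => [[] []] /=; rewrite -exits_flip; try lia; congr (exits _ _ _ _); ring.
Qed.

(** Let p > 0 and b = s + t. Two exits would need 2p + b < 0 and 2p - b < 0, or both signs of s - t,
    or, up to the sign of b, p + q + b >= 0 > p + q - b together with 2p + b < 0. *)
Lemma exits_exclusiveN (p s t q : int) :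
  p != 0 -> s - t != 0 -> ~~ (exits p s t q && exits p (- s) (- t) q).
Proof.
move=> p0 y0; rewrite /exits.
case: (ltrP p 0) => ?; case: (ltrP (p + q + (s + t)) 0) => ?.
all: by case: (ltrP (p + q + (- s - t)) 0) => ? /=; lia.
Qed.

Lemma exits_exclusive_swap (p s t q : int) :
  p != 0 -> q != 0 -> s - t != 0 -> p + q + s + t != 0 ->
  ~~ (exits p s t q && exits q t s p).
Proof.
move=> p0 q0 y0 n0; rewrite /exits (addrC q p) (addrC t s).
case: (ltrP p 0) => ?; case: (ltrP q 0) => ?.
all: by case: (ltrP (p + q + (s + t)) 0) => ? /=; lia.
Qed.

Lemma exits_exclusive_swapN (p s t q : int) :
  p != 0 -> q != 0 -> s - t != 0 -> p + q - s - t != 0 ->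
  ~~ (exits p s t q && exits q (- t) (- s) p).
Proof.
move=> p0 q0 y0 n0; rewrite /exits.
case: (ltrP p 0) => ?; case: (ltrP q 0) => ?; case: (ltrP (p + q + (s + t)) 0) => ?.
all: by case: (ltrP (q + p + (- t - s)) 0) => ? /=; lia.
Qed.

(** The three preceding lemmas cover the six pairs of sides, up to negating s and t and to
    exchanging p with q and s with t. *)
Lemma reduction_flow_inj D K i j v : admissible D K -> D v -> reduction_flow i v ->
  reduction_flow j v -> i = j.
Proof.
move=> ad Dv; have [+ _ _] := ad v Dv.
case: v {Dv} => [[[p s] t] q] /= /and5P [p0 _ q0 y0 /and5P[n0 m0 _ _ _]].
have E1 := exits_exclusiveN p s t q p0 y0.
have E2 : ~~ (exits q t s p && exits q (- t) (- s) p).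
  by apply: exits_exclusiveN => //; clear -y0; lia.
have E3 := exits_exclusive_swap p s t q p0 q0 y0 n0.
have E4 : ~~ (exits p (- s) (- t) q && exits q (- t) (- s) p).
  by apply: exits_exclusive_swap => //; clear -y0 m0; lia.
have E5 := exits_exclusive_swapN p s t q p0 q0 y0 m0.
have E6 : ~~ (exits p (- s) (- t) q && exits q t s p).
  rewrite -{2}(opprK t) -{2}(opprK s).
  by apply: exits_exclusive_swapN => //; clear -y0 n0; lia.
case: i => [[] []]; case: j => [[] []] //=; rewrite !(mul1r, mulN1r).
all: by move: E1 E2 E3 E4 E5 E6; do 4!case: (exits _ _ _ _).
Qed.

Lemma euclid_flow_flip D K j v : (0 < K)%N -> admissible D K -> D v ->
  euclid_flow j (flip j v) = ~~ euclid_flow j v.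
Proof.
move=> K0 ad Dv; have [+ + _] := ad v Dv.
case: v {Dv} => [[[p s] t] q] /= /and5P [? ? ? ? _] dt.
(* In a tie the second row decides; a tie there as well would make the determinant vanish, against K
   > 0. *)
have H1 : p = s -> q != t by move=> E; apply/eqP => F; move: dt; rewrite E F; lia.
have H2 : p = - s -> q != - t by move=> E; apply/eqP => F; move: dt; rewrite E F; lia.
clear dt; case: (ltrgtP `|p| `|s|) => h.
- clear H1 H2; case: j => [[] []] /=;
  rewrite ?mul1r ?mulN1r ?mulr1 ?mulrN1 ?mulNr ?mul1r ?opprK; case: (ltrP p 0) => ?;
  case: (ltrP s 0) => ?; lia.
- clear H1 H2; case: j => [[] []] /=;
  rewrite ?mul1r ?mulN1r ?mulr1 ?mulrN1 ?mulNr ?mul1r ?opprK; case: (ltrP p 0) => ?;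
  case: (ltrP s 0) => ?; lia.
- have [E|E] : p = s \/ p = - s by lia.
  + have {H1 H2} ? := H1 E.
    case: j => [[] []] /=; rewrite ?mul1r ?mulN1r ?mulr1 ?mulrN1 ?mulNr ?mul1r ?opprK;
      case: (ltrP p 0) => ?; lia.
  + have {H1 H2} ? := H2 E.
    case: j => [[] []] /=; rewrite ?mul1r ?mulN1r ?mulr1 ?mulrN1 ?mulNr ?mul1r ?opprK;
      case: (ltrP p 0) => ?; lia.
Qed.

Lemma euclid_flow_inj D K i j v : admissible D K -> D v -> euclid_flow i v ->
  euclid_flow j v -> i = j.
Proof.
move=> ad Dv; have [+ _ _] := ad v Dv.
case: v {Dv} => [[[p s] t] q] /= /and5P [? ? ? ? _].
case: (ltrgtP `|p| `|s|) => h.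
- have P1 : (p == - s) = false by lia.
  have P2 : (p == s) = false by lia.
  have P3 : (s == - p) = false by lia.
  have P4 : (s == p) = false by lia.
  have P5 : (- s < 0) = ~~ (s < 0) by lia.
  case: i => [[] []]; case: j => [[] []] //=;
    rewrite ?mul1r ?mulN1r ?opprK ?P1 ?P2 ?P3 ?P4 ?P5 //=; by case: (p < 0); case: (s < 0).
- have P1 : (p == - s) = false by lia.
  have P2 : (p == s) = false by lia.
  have P3 : (s == - p) = false by lia.
  have P4 : (s == p) = false by lia.
  have P5 : (- s < 0) = ~~ (s < 0) by lia.
  case: i => [[] []]; case: j => [[] []] //=;
    rewrite ?mul1r ?mulN1r ?opprK ?P1 ?P2 ?P3 ?P4 ?P5 //=; by case: (p < 0); case: (s < 0).
- case: i => [[] []]; case: j => [[] []] //=; rewrite ?mul1r ?mulN1r ?opprK.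
  all: lia.
Qed.

(* In this lemma and in the next one, the products p * q and s * t differ by at most
   K, so that when an entry of the matrix would grow, all the entries at stake
   are themselves bounded by K. *)
Lemma exits_bound_same_sign (p s t q K R : int) :
  0 < K -> 3 * K <= R -> - K <= p * q - s * t <= K ->
  `|p| <= R -> `|s| <= R -> `|t| <= R -> `|q| <= R ->
  0 < p -> 0 < p + q + s + t -> 2 * p + s + t < 0 ->
  (`|s + 2 * p| <= R) && (`|q + 2 * t| <= R).
Proof.
move=> K0 KR dt p1 s1 t1 q1 p0 n0 c0.
have pq : p < q by lia.
have h1 : 0 < t -> t <= K /\ q <= K.
  move=> t0; have ? : s < 0 by lia.
  nia.
have h2 : 0 <= s -> t < 0 -> - t * 2 - q <= 3 * K.
  move=> s0 t0. have [E|?] := eqVneq s 0; last first.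
    have : - t <= K by nia. lia.
  move: dt n0; rewrite E => dt n0. nia.
(* With - t = q + i and - s = p - j one has 0 < i < j and p < q, so that j (q + i) - i p is at least
   q + i = - t. *)
have h3 : s < 0 -> q < - t -> - t <= K.
  move=> s0 tq.
  have [i Ei] : exists i, - t = q + i by exists (- t - q); ring.
  have [j Ej] : exists j, - s = p - j by exists (p + s); ring.
  have ? : 0 < i < j by lia.
  have ? : j * (q + i) - i * p <= K.
    have <- : p * q - (- s) * (- t) = j * (q + i) - i * p by rewrite Ei Ej; ring.
    by rewrite mulrNN; lia.
  nia.
lia.
Qed.

Lemma exits_bound_opposite_sign (p s t q K R : int) :
  0 < K -> 3 * K <= R -> - K <= p * q - s * t <= K ->
  `|p| <= R -> `|s| <= R -> `|t| <= R -> `|q| <= R -> q != 0 ->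
  0 < p -> p + q + s + t < 0 -> s < t ->
  (`|s + 2 * p| <= R) && (`|q + 2 * t| <= R).
Proof.
move=> K0 KR dt p1 s1 t1 q1 qn p0 n0 st.
have [s0|s0] := lerP 0 s.
  have ? : 0 < t by lia.
  have ? : - q <= K by nia.
  lia.
have [q0|q0] : q < 0 \/ 0 < q by lia.
  have hp : - s < p -> p <= K.
    move=> sp; have [t0|t0] := lerP 0 t; last by nia.
    have [W ?] : exists W, q = - t - W by exists (- q - t); ring.
    have [i ?] : exists i, p = - s + i by exists (p + s); ring.
    have ? : p * W + i * t <= K by subst; lia.
    nia.
  have ht : - q < t -> t <= K.
    move=> qt.
    have [W ?] : exists W, t = - q + W by exists (q + t); ring.
    have [i ?] : exists i, - s = p + i by exists (- p - s); ring.
    have Es : s = - (p + i) by lia.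
    have ? : i * t + p * W <= K.
      by rewrite (_ : i * t + p * W = p * q - s * t); [lia|]; rewrite Es; subst t; ring.
    nia.
  have htn : t < 0 -> - q - 2 * t <= 3 * K by move=> ?; nia.
  lia.
have hp : - s < p -> p <= K.
  move=> sp; have ? : t < 0 by lia.
  have [j ?] : exists j, p = - s + j by exists (p + s); ring.
  have [i ?] : exists i, - t = q + i by exists (- t - q); ring.
  have Et : t = - (q + i) by lia.
  have ? : (- s) * i - j * q <= K.
    by rewrite (_ : (- s) * i - j * q = - (p * q - s * t)); [lia|]; rewrite Et; subst p; ring.
  have ? : j < i by lia.
  nia.
have ht : q < - t -> - t <= K.
  move=> qt; have [ps|ps] := lerP p (- s); last by have := hp ps; lia.
  have [j ?] : exists j, - s = p + j by exists (- s - p); ring.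
  have [i ?] : exists i, - t = q + i by exists (- t - q); ring.
  have Et : t = - (q + i) by lia.
  have Ep : p = - s - j by lia.
  have ? : (- s) * i + j * q <= K.
    by rewrite (_ : (- s) * i + j * q = - (p * q - s * t)); [lia|]; rewrite Et Ep; ring.
  nia.
have htp : 0 <= t -> q + 2 * t <= 3 * K by move=> ?; nia.
lia.
Qed.

(** Negating the matrix preserves the determinant and the exit, so p may be taken positive; the two
    disjuncts of [exits] are then the two preceding lemmas. *)
Lemma exits_bound (p s t q K R : int) : 0 < K -> 3 * K <= R -> - K <= p * q - s * t <= K ->
  `|p| <= R -> `|s| <= R -> `|t| <= R -> `|q| <= R ->
  p != 0 -> q != 0 -> s - t != 0 -> p + q + s + t != 0 -> 2 * p + s + t != 0 ->
  exits p s t q -> (`|s + 2 * p| <= R) && (`|q + 2 * t| <= R).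
Proof.
move=> K0 KR dt p1 s1 t1 q1 p0 q0 y0 n0 c0.
wlog pp : p s t q dt p1 s1 t1 q1 p0 q0 y0 n0 c0 / 0 < p => [H o|].
  have [pn|pp] := ltrP p 0; last by apply: H => //; lia.
  suff : (`|- s + 2 * - p| <= R) && (`|- q + 2 * - t| <= R) by lia.
  by rewrite /exits in o; apply: H; rewrite ?mulrNN // /exits; lia.
rewrite /exits; have -> : (p < 0) = false by lia.
move=> o; have [[? ?]|[? ?]] : (0 < p + q + s + t
  /\ 2 * p + s + t < 0) \/ (p + q + s + t < 0 /\ s < t) by lia.
  exact: (exits_bound_same_sign p s t q K R).
exact: (exits_bound_opposite_sign p s t q K R).
Qed.

Lemma norm_sign_of b (x : int) : `|sign_of b * x| = `|x|.
Proof. by case: b; rewrite ?mul1r ?mulN1r ?normrN. Qed.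

Lemma sign_ofM b (x y : int) : (sign_of b * x) * (sign_of b * y) = x * y.
Proof. by case: b; rewrite ?mul1r ?mulN1r ?mulrNN. Qed.

Lemma reduction_flow_states D K R j v : admissible D K -> (3 * K <= R)%N -> (0 < K)%N ->
  v \in states D R -> reduction_flow j v -> flip j v \in states D R.
Proof.
move=> ad KR K0 vS; have Dv : D v by move: vS; rewrite mem_filter => /andP [].
have [nd dt Dm] := ad v Dv; move: {Dm Dv} (Dm j) nd dt vS.
have K0' : 0 < K%:Z by lia.
have KR' : 3 * K%:Z <= R%:Z by lia.
case: v => [[[p s] t] q]; rewrite /det => Dm /and5P [p0 s0 q0 y0 /and5P[n0 m0 c0 d0 /andP[e0
  f0]]] dt.
have {}dt : - K%:Z <= p * q - s * t <= K%:Z by lia.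
rewrite mem_states => /and5P [_ pR sR tR qR]; move: Dm.
case: j => [[] b] Dm; rewrite [flip _ _]/= mem_states Dm => o.
- have h1 : sign_of b * t - sign_of b * s != 0 by clear dt; case: b {Dm o} => /=; lia.
  have h2 : q + p + sign_of b * t + sign_of b * s != 0 by clear dt; case: b {Dm o h1} => /=; lia.
  have h3 : 2 * q + sign_of b * t + sign_of b * s != 0 by clear dt;
    case: b {Dm o h1 h2} => /=; lia.
  have := exits_bound q (sign_of b * t) (sign_of b
    * s) p K R K0' KR' _ qR _ _ pR q0 p0 h1 h2 h3 o.
  rewrite !norm_sign_of sign_ofM (mulrC q) (mulrC t) => /(_ dt tR sR) /andP[h4 h5].
  have -> : `|- p - 2 * sign_of b * s| = `|p + 2 * (sign_of b * s)| by rewrite -normrN;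
    congr (`|_|); ring.
  have -> : `|- t - 2 * sign_of b * q| = `|sign_of b * t + 2 * q| by clear; case: b => /=; lia.
  by rewrite sR qR h4 h5.
- have h1 : sign_of b * s - sign_of b * t != 0 by clear dt; case: b {Dm o} => /=; lia.
  have h2 : p + q + sign_of b * s + sign_of b * t != 0 by clear dt; case: b {Dm o h1} => /=; lia.
  have h3 : 2 * p + sign_of b * s + sign_of b * t != 0 by clear dt;
    case: b {Dm o h1 h2} => /=; lia.
  have := exits_bound p (sign_of b * s) (sign_of b
    * t) q K R K0' KR' _ pR _ _ qR p0 q0 h1 h2 h3 o.
  rewrite !norm_sign_of sign_ofM => /(_ dt sR tR) /andP[h4 h5].
  have -> : `|- q - 2 * sign_of b * t| = `|q + 2 * (sign_of b * t)| by rewrite -normrN;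
    congr (`|_|); ring.
  have -> : `|- s - 2 * sign_of b * p| = `|sign_of b * s + 2 * p| by clear; case: b => /=; lia.
  by rewrite pR tR h4 h5.
Qed.

(** Take 0 < p < - s. If q and t have the same sign, so do p q and - s t, and both are bounded by K.
    Otherwise the only danger is |t| > |q|, and then the determinant is at least |t| in absolute
    value. *)
Lemma euclid_step_bound (p s t q K R : int) : 0 < K -> 3 * K <= R -> - K <= p * q - s * t <= K ->
  `|t| <= R -> `|q| <= R -> p != 0 -> s != 0 ->
  `|p| < `|s| -> (p < 0) != (s < 0) -> `|q + 2 * t| <= R.
Proof.
move=> K0 KR dt t1 q1 p0 s0 ps sg.
wlog pp : p s dt p0 s0 ps sg / 0 < p => [H|].
  have [pn|pp] := ltrP p 0; last by apply: (H p s) => //; lia.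
  by apply: (H (- p) (- s)); rewrite ?mulNr //; lia.
have [S ES] : exists S, s = - S by exists (- s); ring.
have ? : p < S by lia.
have {dt} dt : - K <= p * q + S * t <= K by move: dt; rewrite ES mulNr opprK.
clear ES ps sg s0.
wlog q0 : q t dt t1 q1 / 0 <= q => [H|].
  have [pn|pp'] := lerP 0 q; first by apply: (H q t) => //; lia.
  have -> : `|q + 2 * t| = `|- q + 2 * - t| by lia.
  by apply: H; rewrite ?mulrN ?normrN //; lia.
have [t0|t0] := lerP 0 t.
  nia.
have [U EU] : exists U, t = - U by exists (- t); ring.
subst t.
have ? : q < U -> U <= K by nia.
lia.
Qed.

Lemma euclid_flow_states D K R j v : admissible D K -> (3 * K <= R)%N -> (0 < K)%N ->
  v \in states D R -> euclid_flow j v -> flip j v \in states D R.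
Proof.
move=> ad KR K0 vS; have Dv : D v by move: vS; rewrite mem_filter => /andP [].
have [nd dt Dm] := ad v Dv; move: {Dm Dv} (Dm j) nd dt vS.
have K0' : 0 < K%:Z by lia.
have KR' : 3 * K%:Z <= R%:Z by lia.
case: v => [[[p s] t] q]; rewrite /det => Dm /and5P [p0 s0 q0 y0 _] dt.
have {}dt : - K%:Z <= p * q - s * t <= K%:Z by lia.
rewrite mem_states => /and5P [_ pR sR tR qR]; move: Dm.
case: j => [[] b] Dm; rewrite [flip _ _]/= mem_states Dm /= => /orP [/andP [h1 h2]|/andP [h1 h2]].
- have h3 : `|sign_of b * t + 2 * q| <= R.
    apply: (euclid_step_bound (sign_of b * s) p q (sign_of b * t) K) => //;
      rewrite ?norm_sign_of ?sign_ofM // 1?eq_sym //.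
    + by clear -dt; lia.
    + by clear -s0; case: b => /=; lia.
  have -> : `|- t - 2 * sign_of b * q| = `|sign_of b * t + 2 * q| by clear; case: b => /=; lia.
  rewrite sR qR h3 !andbT /=; clear -h1 h2 p0 s0 pR; case: b h2 => /=; lia.
- rewrite sR qR /=; clear -h1 h2 tR pR; case: b h1 h2 => /=; lia.
- have h3 : `|q + 2 * (sign_of b * t)| <= R.
    apply: (euclid_step_bound p (sign_of b * s) (sign_of b * t) q K) => //;
      rewrite ?norm_sign_of ?sign_ofM //.
    by clear -s0; case: b => /=; lia.
  have -> : `|- q - 2 * sign_of b * t| = `|q + 2 * (sign_of b * t)| by rewrite -normrN;
    congr (`|_|); ring.
  rewrite pR tR h3 !andbT /=; clear -h1 h2 p0 s0 sR; case: b h2 => /=; lia.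
- rewrite pR tR /=.
  (* In this tie the determinant factors as p (q + e t). *)
  have : `|q + sign_of b * t| <= K.
    have {}dt : - K%:Z <= p * (q + sign_of b * t) <= K%:Z.
      by move: dt; rewrite (eqP h1) (_ : p * q - _ = p * (q + sign_of b * t)) //; ring.
    clear -dt p0; nia.
  clear -h1 h2 tR sR KR' ; case: b h1 h2 => /=; lia.
Qed.

(** * Four odd squares *)

Lemma sum_antisym (T : eqType) (s : seq T) (P : pred T) (h : T -> T) (F : T -> int) :
  uniq s ->
  (forall x, x \in s -> P x -> [/\ h x \in s, P (h x), h (h x) = x & F (h x) = - F x]) ->
  \sum_(x <- s | P x) F x = 0.
Proof.
move=> us hs; rewrite -big_filter; set r := [seq x <- s | P x].
have hr x : x \in r -> [/\ h x \in r, h (h x) = x & F (h x) = - F x].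
  by rewrite mem_filter => /andP [Px xs]; have [? ? ? ?] := hs x xs Px; rewrite mem_filter;
    split=> //; apply/andP.
have ur : uniq r by rewrite filter_uniq.
suff E : \sum_(x <- r) F x = - \sum_(x <- r) F x by move: (\sum_(x <- r) F x) E => S; lia.
have pr : perm_eq (map h r) r.
  apply: uniq_perm => // [|y].
    rewrite map_inj_in_uniq // => x y xr yr E.
    by have [_ <- _] := hr x xr; rewrite E; have [] := hr y yr.
  apply/mapP/idP => [[x xr ->]|yr]; first by have [] := hr x xr.
  by exists (h y); have [] := hr y yr.
rewrite -{1}(perm_big _ pr) /= big_map -sumrN !big_seq; apply: eq_bigr => x xr.
by have [] := hr x xr.
Qed.

Lemma big_box (T : Type) (V : nmodType) (r : seq T) R (F : T * int -> V) :
  \sum_(v <- box r R) F v = \sum_(u <- r) \sum_(x <- irange R) F (u, x).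
Proof. by rewrite big_allpairs. Qed.

Lemma sqr_absz (x : int) : (absz x ^ 2)%N%:Z = x ^+ 2.
Proof. by rewrite -abszX gez0_abs ?sqr_ge0. Qed.

Lemma odd_sqr_mod8 (x : int) : (x %% 2 = 1)%Z -> (x ^+ 2 %% 8 = 1)%Z.
Proof.
move=> x1; have [X ->] : exists X, x = 2 * X + 1 by exists (x %/ 2)%Z; lia.
have [Y] : exists Y, X = 2 * Y \/ X = 2 * Y + 1 by exists (X %/ 2)%Z; lia.
case=> ->.
  rewrite (_ : _ ^+ 2 = (2 * Y ^+ 2 + Y) * 8 + 1); first by rewrite modzMDl.
  ring.
rewrite (_ : _ ^+ 2 = (2 * Y ^+ 2 + 3 * Y + 1) * 8 + 1); first by rewrite modzMDl.
ring.
Qed.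

Lemma even_sqr_mod4 (x : int) : (x %% 2 = 0)%Z -> (x ^+ 2 %% 4 = 0)%Z.
Proof.
move=> x1; have [X ->] : exists X, x = 2 * X by exists (x %/ 2)%Z; lia.
by rewrite (_ : _ ^+ 2 = X ^+ 2 * 4); [rewrite modzMl|ring].
Qed.

Lemma odd_mulz (x y : int) : (((x * y) %% 2)%Z == 1) = ((x %% 2)%Z == 1) && ((y %% 2)%Z == 1).
Proof.
have [X HX] : exists X, x = 2 * X \/ x = 2 * X + 1 by exists (x %/ 2)%Z; lia.
have [Y HY] : exists Y, y = 2 * Y \/ y = 2 * Y + 1 by exists (y %/ 2)%Z; lia.
case: HX HY => -> [] ->; lia.
Qed.

(** Up to the choice of L, the triples of Heath-Brown's proof of the two squares theorem. *)
Definition solutions L R : seq (int * int * int) :=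
  [seq v <- box (box (irange R) R) R |
    let: (x, d, e) := v in [&& 0 < d, 0 < e & x ^+ 2 + 4 * d * e == L]].

Lemma mem_solutions L R x d e : (`|L| <= R)%N ->
  ((x, d, e) \in solutions L R) = [&& 0 < d, 0 < e & x ^+ 2 + 4 * d * e == L].
Proof.
move=> LR; rewrite mem_filter !mem_box mem_irange.
apply: andb_idr => /and3P [d0 e0 /eqP E].
have ? : `|x| <= x ^+ 2 by rewrite expr2; nia.
have ? : d <= 4 * d * e by nia.
have ? : e <= 4 * d * e by nia.
lia.
Qed.

Lemma solutions_uniq L R : uniq (solutions L R).
Proof. by rewrite filter_uniq // !box_uniq // irange_uniq. Qed.

(* Twice the summand is (d + e)(e - x)(d + x) up to terms that are antisymmetric under
   (x, d, e) |-> (- x, e, d) or under x |-> - x.  The two halves x < e - d and x > e - d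
   have involutions that negate (d + e)(e - x)(d + x). *)
Lemma sum_solutions L R : (`|L| <= R)%N -> (L %% 8 = 5)%Z ->
  \sum_(v <- solutions L R) (let: (x, d, e) := v in (d * e - x ^+ 2) * d) = 0.
Proof.
move=> LR L5.
have us := solutions_uniq L R.
pose E v := let: (x, d, e) := v : int * int * int in (d + e) * (e - x) * (d + x).
(* As L = 5 mod 8, x and d e are odd; hence e - d is even, and x = e - d never occurs. *)
have odds x d e : (x, d, e) \in solutions L R ->
  [/\ (x %% 2 = 1)%Z, (d %% 2 = 1)%Z & (e %% 2 = 1)%Z].
  rewrite mem_solutions // => /and3P [_ _ /eqP H].
  have [x1|x0] : (x %% 2 = 1)%Z \/ (x %% 2 = 0)%Z by lia.
    have := odd_sqr_mod8 x x1; have := odd_mulz d e => h1 h2.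
    have : ((d * e) %% 2)%Z == 1 by lia.
    by rewrite h1 => /andP [/eqP ? /eqP ?].
  have := even_sqr_mod4 x x0; lia.
have sumE : \sum_(v <- solutions L R | v.1.1 < v.2 - v.1.2) E v = 0.
  apply: (sum_antisym _ _ _ (fun v => let: (x, d, e) := v in (- x - 2 * d, d, e - x - d))) => //.
  move=> [[x d] e]; rewrite mem_solutions // => /and3P[d0 e0 /eqP H] /= xde.
  rewrite mem_solutions //; split.
  - by rewrite d0 -H; apply/and3P; split => //; [lia|apply/eqP; ring].
  - lia.
  - by repeat congr pair; ring.
  - ring.
have sumE' : \sum_(v <- solutions L R | ~~ (v.1.1 < v.2 - v.1.2)) E v = 0.
  apply: (sum_antisym _ _ _ (fun v => let: (x, d, e) := v in (2 * e - x, d + x - e, e))) => //.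
  move=> [[x d] e] vS; have [x1 d1 e1] := odds _ _ _ vS; move: vS.
  rewrite mem_solutions // => /and3P[d0 e0 /eqP H] /= xde.
  rewrite mem_solutions //; split.
  - by rewrite e0 -H; apply/and3P; split => //; [lia|apply/eqP; ring].
  - lia.
  - by repeat congr pair; ring.
  - ring.
have sumG : \sum_(v <- solutions L R) (let: (x, d, e) := v in (d - e) * (d * e - x ^+ 2)) = 0.
  apply: (sum_antisym _ _ xpredT (fun v => let: (x, d, e) := v in (- x, e, d))) => //.
  move=> [[x d] e]; rewrite mem_solutions // => /and3P[d0 e0 /eqP H] _.
  rewrite mem_solutions // d0 e0 opprK -H; split => //; last by ring.
  by apply/eqP; ring.
have sumG' : \sum_(v <- solutions L R) (let: (x, d, e) := v in x * (d ^+ 2 - e ^+ 2)) = 0.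
  apply: (sum_antisym _ _ xpredT (fun v => let: (x, d, e) := v in (- x, d, e))) => //.
  move=> [[x d] e]; rewrite mem_solutions // => /and3P[d0 e0 /eqP H] _.
  rewrite mem_solutions // d0 e0 opprK -H; split => //; last by ring.
  by apply/eqP; ring.
have sE : \sum_(v <- solutions L R) E v = 0.
  by rewrite (bigID (fun v : int * int * int => v.1.1 < v.2 - v.1.2)) /= sumE sumE'.
have H : (\sum_(v <- solutions L R) (let: (x, d, e) := v in (d * e - x ^+ 2) * d)) * 2 =
  \sum_(v <- solutions L R) E v + \sum_(v <- solutions L R) (let: (x, d, e) :=
    v in (d - e) * (d * e - x ^+ 2))
   + \sum_(v <- solutions L R) (let: (x, d, e) := v in x * (d ^+ 2 - e ^+ 2)).
  by rewrite big_distrl /= -!big_split /=; apply: eq_bigr => -[[x d] e] _ /=; ring.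
move: H; rewrite sE sumG sumG'; move: (\sum_(v <- _) _) => S; lia.
Qed.

Definition oddz (x : int) : bool := (x %% 2)%Z == 1.

Definition square_series (P : pred int) (R : nat) : {poly int} :=
  \sum_(x <- irange R | P x) 'X^(absz x ^ 2).

Lemma coef_square_series_mul P R (p : {poly int}) (n : nat) :
  (square_series P R * p)`_n = \sum_(x <- irange R | P x
    && (absz x ^ 2 <= n)%N) p`_(n - absz x ^ 2).
Proof.
rewrite /square_series mulr_suml coef_sum big_mkcondr /=; apply: eq_bigr => x _.
by rewrite coefXnM ltnNge; case: leqP.
Qed.

(* From the derivative of theta^5: L times the coefficient of X^L in theta^5 is 5 times
   that of theta^4 * (X * theta'). *)
Lemma theta4_rec R (L : nat) (th := square_series oddz R) :
  \sum_(x <- irange R | oddz x && (absz x ^ 2 <= L)%N) (L%:Z - 5 * x ^+ 2)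
    * (th ^+ 4)`_(L - absz x ^ 2) = 0.
Proof.
have H1 : (th ^+ 5)`_L = \sum_(x <- irange R | oddz x
  && (absz x ^ 2 <= L)%N) (th ^+ 4)`_(L - absz x ^ 2).
  by rewrite exprS coef_square_series_mul.
have H2 : L%:Z * (th ^+ 5)`_L = 5 * \sum_(x <- irange R | oddz x
  && (absz x ^ 2 <= L)%N) x ^+ 2 * (th ^+ 4)`_(L - absz x ^ 2).
  have -> : L%:Z * (th ^+ 5)`_L = ('X * (th ^+ 5)^`())`_L.
    rewrite coefXM; case: L {H1} => [|L] /=; first by rewrite mul0r.
    by rewrite coef_deriv -mulr_natl natz.
  rewrite deriv_exp /= mulrnAr coefMn mulrA [RHS]mulr_natl; congr (_ *+ _).
  have -> : 'X * th^`() = \sum_(x <- irange R | oddz x) (x ^+ 2) *: 'X^(absz x ^ 2).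
    rewrite /th /square_series raddf_sum mulr_sumr /=; apply: eq_bigr => x _.
    rewrite -sqr_absz -natz; case: (absz x ^ 2)%N => [|m];
      first by rewrite expr0 -polyC1 derivC mulr0 scale0r.
    by rewrite derivXn mulrnAr -exprS scaler_nat.
  rewrite mulr_suml coef_sum [RHS]big_mkcondr /=; apply: eq_bigr => x _.
  by rewrite -scalerAl coefZ coefXnM ltnNge; case: leqP; rewrite ?mulr0.
rewrite -[RHS](subrr (L%:Z * (th ^+ 5)`_L)).
rewrite [X in _ * X - _]H1 H2 !mulr_sumr -sumrB; apply: eq_bigr => x _; ring.
Qed.

Definition divisor_sum (R M : nat) : int :=
  \sum_(d <- irange R) \sum_(e <- irange R | [&& 0 < d, 0 < e & d * e == M%:Z]) d.

(** This is [sum_solutions] grouped by x: since 4 d e = L - x^2, four times d e - x^2 is L - 5 x^2,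
    the factor in [theta4_rec]. *)
Lemma divisor_sum_rec R (L : nat) : (L <= R)%N -> (L %% 8 = 5)%N ->
  \sum_(x <- irange R | oddz x && (absz x ^ 2 <= L)%N) (L%:Z - 5 * x ^+ 2)
    * divisor_sum R ((L - absz x ^ 2) %/ 4) = 0.
Proof.
move=> LR L5; have LR' : (`|L%:Z| <= R)%N by lia.
have := sum_solutions L R LR' _ => /(_ _) H.
have {H} : \sum_(v <- solutions L R) (let: (x, d, e) :=
  v in (d * e - x ^+ 2) * d) = 0 by apply: H; lia.
rewrite /solutions big_filter big_mkcond !big_box /= => H.
move/(congr1 (fun z => 4 * z)): H; rewrite mulr0 => H; rewrite -[RHS]H.
rewrite mulr_sumr [LHS]big_mkcond; apply: eq_bigr => x _.
rewrite /divisor_sum mulr_sumr mulr_sumr.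
case: ifP => [/andP [x1 xL]|xF].
  apply: eq_bigr => d _; rewrite [in RHS]mulr_sumr mulr_sumr [LHS]big_mkcond;
    apply: eq_bigr => e _.
  have x8 := odd_sqr_mod8 x (eqP x1).
  have Ex := sqr_absz x.
  set m := (_ %/ 4)%N; have Em : 4 * m%:Z = L%:Z - x ^+ 2 by rewrite /m; lia.
  have -> : (x ^+ 2 + 4 * d * e == L) = (d * e == m) by rewrite -mulrA; lia.
  case: ifP => [/and3P[_ _ /eqP ->]|_]; rewrite ?mulr0 // mulrA; congr (_ * _); lia.
symmetry; apply: big1 => d _; rewrite mulr_sumr; apply: big1 => e _.
case: ifP => [/and3P[d0 e0 /eqP E]|_]; last by rewrite mulr0.
exfalso; move/negP: xF; apply; apply/andP; split; last first.
  have := sqr_absz x; have : 0 < d * e by exact: mulr_gt0. rewrite -mulrA in E; lia.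
rewrite /oddz; have [//|/eqP x0] := boolP (_ == _).
have := even_sqr_mod4 x; rewrite -mulrA in E; lia.
Qed.

Lemma sum_irange_pm1 R (F : int -> int) : (0 < R)%N ->
  (forall x, x \in irange R -> x != 1 -> x != -1 -> F x = 0) ->
  \sum_(x <- irange R) F x = F 1 + F (-1).
Proof.
move=> R0 HF; rewrite (bigD1_seq 1) ?irange_uniq ?mem_irange //=.
congr (_ + _); rewrite big_mkcond (bigD1_seq (-1)) ?irange_uniq ?mem_irange //=.
rewrite big_seq_cond big1 ?addr0 // => x /andP[xR xm]; case: ifP => // x1; exact: HF.
Qed.

(** The series starts with 2 X, and its other exponents are at least 9. *)
Lemma coef_theta_mul R n p : (0 < R)%N -> (n < 8)%N ->
  (square_series oddz R * p)`_n.+1 = 2 * p`_n.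
Proof.
move=> R0 n8; rewrite coef_square_series_mul big_mkcond sum_irange_pm1 //.
  by rewrite /= subn1 /= -mulr2n mulr_natl.
move=> x xR x1 xm; case: ifP => // /andP[]; rewrite /oddz => ox.
have ? : (3 <= absz x)%N by lia.
have : (3 ^ 2 <= absz x ^ 2)%N by rewrite leq_exp2r.
lia.
Qed.

Lemma theta4_4 R : (0 < R)%N -> (square_series oddz R ^+ 4)`_4 = 16.
Proof.
by move=> R0; rewrite !exprS expr0 !coef_theta_mul // coef1.
Qed.

Lemma divisor_sum1 R : (0 < R)%N -> divisor_sum R 1 = 1.
Proof.
move=> R0; rewrite /divisor_sum (bigD1_seq 1) ?irange_uniq ?mem_irange //=.
rewrite big_mkcond (bigD1_seq 1) ?irange_uniq ?mem_irange //=.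
rewrite big1 => [|e e1]; last by case: ifP => // /andP[_]; rewrite mul1r (negbTE e1).
rewrite big1 => [|d d1]; first by rewrite !addr0.
apply: big1 => e /and3P[d0 e0 /eqP E]; move: d1; nia.
Qed.

(** Both sides satisfy the same recurrence at L = 4 M + 1. Its terms x = 1 and x = -1 carry the
    factor L - 5 = 4 (M - 1), so they determine the value at M unless M = 1, the base case; other x
    lead to smaller odd numbers. *)
Lemma theta4_coef R M : (4 * M < R)%N -> odd M ->
  (square_series oddz R ^+ 4)`_(4 * M) = 16 * divisor_sum R M.
Proof.
elim/ltn_ind: M => M IH MR oM; have R0 : (0 < R)%N by lia.
have [M1|M1] := eqVneq M 1%N.
  by rewrite M1 muln1 theta4_4 // divisor_sum1 // mulr1.
have L5 : ((4 * M).+1 %% 8 = 5)%N by lia.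
have := theta4_rec R (4 * M).+1; have := divisor_sum_rec R (4 * M).+1 MR L5.
move/(congr1 (fun z => 16 * z)); rewrite mulr0 mulr_sumr => H1 H2.
have : \sum_(x <- irange R | oddz x && (absz x ^ 2 <= (4 * M).+1)%N)
   ((4 * M).+1%:Z - 5 * x ^+ 2) * ((square_series oddz R ^+ 4)`_((4 * M).+1 - absz x ^ 2) -
     16 * divisor_sum R (((4 * M).+1 - absz x ^ 2) %/ 4)) = 0.
  rewrite -[RHS](subrr 0) -[X in _ = X - _]H2 -[X in _ = _ - X]H1 -sumrB;
    apply: eq_bigr => x _; ring.
rewrite big_mkcond sum_irange_pm1 //.
  rewrite /= subn1 /= mulKn // -mulr2n.
  rewrite expr1n; move: (_`_(4 * M)) (divisor_sum R M) => u v h.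
  have : (M%:Z - 1) * (u - 16 * v) = 0 by lia.
  by move/eqP; rewrite mulf_eq0 => /orP [|]; lia.
move=> x _ x1 xm1; case: ifP => // /andP[ox xM].
have x8 := odd_sqr_mod8 x (eqP ox); have xx := sqr_absz x.
have x3 : (3 <= absz x)%N by move: ox; rewrite /oddz; lia.
have x9 : (3 ^ 2 <= absz x ^ 2)%N by rewrite leq_exp2r.
set m := (_ %/ 4)%N; have -> : ((4 * M).+1 - absz x ^ 2 = 4 * m)%N by lia.
rewrite IH ?subrr ?mulr0 //; lia.
Qed.

(** * From four odd squares to two odd and two even squares *)

Definition evenz (x : int) : bool := (x %% 2)%Z == 0.

Lemma coef_square_series_neq0 P R (p : {poly int}) n : (square_series P R * p)`_n != 0 ->
  exists x, [/\ P x, (absz x ^ 2 <= n)%N & p`_(n - absz x ^ 2) != 0].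
Proof.
rewrite coef_square_series_mul => h.
have [/hasP [x _ /and3P[? ? ?]]|/hasPn hN] :=
  boolP (has (fun x => [&& P x, (absz x ^ 2 <= n)%N & p`_(n - absz x ^ 2) != 0]) (irange R)).
  by exists x.
case/eqP: h; rewrite big_seq_cond big1 // => x /and3P[xR Px xn].
by have := hN x xR; rewrite Px xn /= negbK => /eqP.
Qed.

Lemma coef_square_series2 P Q R n :
  (square_series P R * square_series Q R)`_n =
  (count (fun v : int * int => [&& P v.1, Q v.2 & v.1 ^+ 2
    + v.2 ^+ 2 == n%:Z]) (box (irange R) R))%:Z.
Proof.
rewrite coef_square_series_mul big_mkcond -sum1_count -[RHS]natz natr_sum [RHS]big_mkcond big_box.
apply: eq_bigr => x _; have xx := sqr_absz x; case: ifP => [/andP[Px xn]|xF].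
  rewrite /square_series coef_sum big_mkcond; apply: eq_bigr => y _.
  have yy := sqr_absz y; rewrite Px coefXn /=; case: (Q y) => //=.
  by do 2![case: eqP => //] => *; lia.
rewrite big1 // => y _; case: ifP => // /and3P[/= Px Qy E]; move: xF; rewrite Px /=.
by have yy := sqr_absz y; lia.
Qed.

Lemma coef_theta2_odd R n : odd n -> (square_series oddz R * square_series oddz R)`_n = 0.
Proof.
move=> on; rewrite coef_square_series2 (eq_count (a2 := pred0)) ?count_pred0 //.
move=> [x y] /=; apply/negP => /and3P[/eqP ox /eqP oy /eqP E].
have := odd_sqr_mod8 x ox; have := odd_sqr_mod8 y oy; lia.
Qed.

Lemma count_split (T : Type) (P Q : pred T) s :
  count P s = (count (fun v => P v && Q v) s + count (fun v => P v && ~~ Q v) s)%N.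
Proof. by elim: s => //= x s ->; case: (P x); case: (Q x) => /=; lia. Qed.

(** Passing from (x, y) to ((x + y) / 2, (x - y) / 2) halves x^2 + y^2. Exactly one of the new
    numbers is odd, since their sum is x; which one it is accounts for the factor 2. *)
Lemma coef_theta2_even R n : (2 * n <= R)%N ->
  (square_series oddz R * square_series oddz R)`_(2 * n) =
    2 * (square_series oddz R * square_series evenz R)`_n.
Proof.
move=> nR; rewrite !coef_square_series2.
set P := fun v : int * int => _; set Q := fun v : int * int => [&& oddz _, evenz _ & _].
have ub := box_uniq _ _ R (irange_uniq R).
have bnd (x y : int) (m : nat) : x ^+ 2 + y ^+ 2 = m%:Z -> (m <= R)%N ->
  `|x| <= R%:Z /\ `|y| <= R%:Z.
  move=> E mR; suff : `|x| <= m%:Z /\ `|y| <= m%:Z by lia.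
  by split; nia.
pose h (v : int * int) : int * int := (((v.1 + v.2) %/ 2)%Z, ((v.1 - v.2) %/ 2)%Z).
pose h' (v : int * int) : int * int := (v.1 + v.2, v.1 - v.2).
pose k (v : int * int) : int * int := (((v.1 - v.2) %/ 2)%Z, ((v.1 + v.2) %/ 2)%Z).
pose k' (v : int * int) : int * int := (v.1 + v.2, v.2 - v.1).
have sqD (x y : int) : (x + y) ^+ 2 + (x - y) ^+ 2 = 2 * (x ^+ 2 + y ^+ 2) by ring.
have E1 : count (fun v => P v && oddz ((v.1 + v.2) %/ 2)%Z) (box (irange R) R) =
  count Q (box (irange R) R).
  apply: (count_bij _ _ _ _ _ _ h h') => // -[x y] _;
    rewrite /P /Q /h /h' /oddz /evenz /= mem_box mem_irange.
    case/andP=> /and3P [ox oy /eqP E] os.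
    set X := ((x + y) %/ 2)%Z in os *; set Y := ((x - y) %/ 2)%Z.
    have ex : x = X + Y by lia.
    have ey : y = X - Y by lia.
    have E' : X ^+ 2 + Y ^+ 2 = n%:Z by have := sqD X Y; rewrite -ex -ey; lia.
    have := bnd _ _ _ E' _; split; [lia|lia|congr pair; lia].
  case/and3P=> ox ey /eqP E.
  have E' : (x + y) ^+ 2 + (x - y) ^+ 2 = (2 * n)%N%:Z by rewrite sqD; lia.
  have := bnd _ _ _ E' nR; split; [lia|lia|congr pair; lia].
have E2 : count (fun v => P v && ~~ oddz ((v.1 + v.2) %/ 2)%Z) (box (irange R) R) =
  count Q (box (irange R) R).
  apply: (count_bij _ _ _ _ _ _ k k') => // -[x y] _;
    rewrite /P /Q /k /k' /oddz /evenz /= mem_box mem_irange.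
    case/andP=> /and3P [ox oy /eqP E] os.
    set Y := ((x + y) %/ 2)%Z in os *; set X := ((x - y) %/ 2)%Z.
    have ex : x = Y + X by lia.
    have ey : y = Y - X by lia.
    have E' : X ^+ 2 + Y ^+ 2 = n%:Z by have := sqD Y X; rewrite -ex -ey; lia.
    have := bnd _ _ _ E' _; split; [lia|lia|congr pair; lia].
  case/and3P=> ox ey /eqP E.
  have E' : (x + y) ^+ 2 + (y - x) ^+ 2 = (2 * n)%N%:Z by have := sqD y x; rewrite (addrC y); lia.
  have := bnd _ _ _ E' nR; split; [lia|lia|congr pair; lia].
rewrite (count_split _ P (fun v => oddz ((v.1 + v.2) %/ 2)%Z)) E1 E2; lia.
Qed.

Lemma sum_ord_even (V : nmodType) (F : nat -> V) n : (forall i, odd i -> F i = 0) ->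
  \sum_(i < (2 * n).+1) F i = \sum_(i < n.+1) F (2 * i)%N.
Proof.
move=> F0; elim: n => [|n IH]; first by rewrite !big_ord_recr !big_ord0.
rewrite mulnS [LHS]big_ord_recr big_ord_recr /= IH [RHS]big_ord_recr /= [X in _ + X
  + _]F0 ?addr0; last by lia.
by congr (_ + F _); lia.
Qed.

(** In the square of theta^2 only even exponents contribute at 4 M, and [coef_theta2_even] extracts
    a factor 2 from each of the two coefficients. *)
Lemma theta2_phi2_coef R M : (4 * M < R)%N -> odd M ->
  (square_series oddz R * square_series evenz R * (square_series oddz R
    * square_series evenz R))`_(2 * M) = 4 * divisor_sum R M.
Proof.
move=> MR oM; have := theta4_coef R M MR oM.
set th := square_series oddz R; set ph := square_series evenz R.
rewrite (_ : th ^+ 4 = (th * th) * (th * th)); last by ring.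
rewrite !coefM (_ : 4 * M = 2 * (2 * M))%N; last by lia.
rewrite (sum_ord_even _ (fun i => (th * th)`_i * (th * th)`_(2 * (2 * M) - i))) => [|i oi];
  last first.
  by rewrite coef_theta2_odd // mul0r.
have -> : \sum_(i < (2 * M).+1) (th * th)`_(2 * i) * (th * th)`_(2 * (2 * M) - 2 * i) =
   4 * \sum_(i < (2 * M).+1) (th * ph)`_i * (th * ph)`_(2 * M - i).
  rewrite [RHS]mulr_sumr; apply: eq_bigr => -[i /= iM] _.
  rewrite -mulnBr !coef_theta2_even; [ring|lia|lia].
lia.
Qed.

(** * Counting the sinks *)

(** With b = s + t and y = s - t, det = M reads 4 p q - b^2 = 4 M - y^2, with b and y odd. *)
Definition classA (M : nat) (v : state) : bool :=
  let: (p, s, t, q) := v in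
  [&& oddz p, oddz s, evenz t, oddz q & (det v == M%:Z) || (det v == - M%:Z)].

(** With s + t = 2 c and s - t = 2 x, det = 2 M reads p q - c^2 = 2 M - x^2; the congruence makes c
    even and x odd. *)
Definition classB (M : nat) (v : state) : bool :=
  let: (p, s, t, q) := v in
  [&& oddz p, oddz s, oddz t, oddz q, ((s + t) %% 4)%Z == 0
    & (det v == (2 * M)%N%:Z) || (det v == - (2 * M)%N%:Z)].

Lemma classA_admissible M : odd M -> admissible (classA M) M.
Proof.
move=> oM [[[p s] t] q] /and5P [op os et oq dt].
have dm j := det_flip j (p, s, t, q).
rewrite /oddz /evenz in op os et oq; split => // [|[a b]].
  by rewrite /nondeg; lia.
have := dm (a, b); rewrite /classA /oddz /evenz; case: a; case: b => /= -> ;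
  rewrite eqr_oppLR eqr_opp orbC dt andbT; clear -op os et oq; lia.
Qed.

Lemma classB_admissible M : odd M -> admissible (classB M) (2 * M).
Proof.
move=> oM [[[p s] t] q] /and5P [op os ot oq /andP[st dt]].
have dm j := det_flip j (p, s, t, q).
rewrite /oddz in op os ot oq; split => // [|[a b]].
  rewrite /nondeg; suff : (p + q + s + t != 0) && (p + q - s - t != 0) by clear dt dm; lia.
  (* The other conditions of [nondeg] hold modulo 4. If one of these two sums vanished, the
     determinant would be - (p + s)(p + t) or - (p - s)(p - t), a multiple of 4, whereas M is
     odd. *)
  apply/andP; split; apply/eqP => E.
    have [a Ea] : exists a, p + s = 2 * a by exists ((p + s) %/ 2)%Z; lia.
    have [b Eb] : exists b, p + t = 2 * b by exists ((p + t) %/ 2)%Z; lia.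
    have Ed : det (p, s, t, q) = - 4 * (a * b).
      have -> : - 4 * (a * b) = - ((2 * a) * (2 * b)) by ring.
      by rewrite -Ea -Eb /det (_ : q = - (p + s + t)); [ring|lia].
    by move: dt; rewrite Ed; lia.
  have [a Ea] : exists a, p - s = 2 * a by exists ((p - s) %/ 2)%Z; lia.
  have [b Eb] : exists b, p - t = 2 * b by exists ((p - t) %/ 2)%Z; lia.
  have Ed : det (p, s, t, q) = - 4 * (a * b).
    have -> : - 4 * (a * b) = - ((2 * a) * (2 * b)) by ring.
    by rewrite -Ea -Eb /det (_ : q = s + t - p); [ring|lia].
  by move: dt; rewrite Ed; lia.
have := dm (a, b); rewrite /classB /oddz; case: a; case: b => /= -> ;
  rewrite eqr_oppLR eqr_opp [X in [&& _, _, _, _, _ & X]]orbC dt andbT;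
    clear -op os ot oq st; lia.
Qed.

Lemma is_sinkE (out : bool * bool -> state -> bool) v :
  is_sink out v = [&& ~~ out (false, false) v, ~~ out (false, true) v, ~~ out (true,
    false) v & ~~ out (true, true) v].
Proof.
apply/forallP/and4P => [H|[? ? ? ?] [[] []]] //.
Qed.

Lemma reduction_sinkE p s t q : nondeg (p, s, t, q) ->
  is_sink reduction_flow (p, s, t, q) =
    [&& (p < 0) == (q < 0), `|s + t| < 2 * `|p| & `|s + t| < 2 * `|q|].
Proof.
rewrite is_sinkE /= /exits !(mul1r, mulN1r) => /and5P [? ? ? ? /and5P[? ? ? ? /andP [? ?]]].
case: (ltrP p 0) => ?; case: (ltrP q 0) => ?; case: (ltrP (p + q + (s + t)) 0) => ?;
  case: (ltrP (p + q + (- s - t)) 0) => ?; lia.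
Qed.

Lemma euclid_sinkE p s t q : nondeg (p, s, t, q) -> det (p, s, t, q) != 0 ->
  is_sink euclid_flow (p, s, t, q) =
    (s == p) && ((t < 0) && (0 < q) || (0 <= t) && (q < 0))
    || (s == - p) && ((t < 0) && (q < 0) || (0 <= t) && (0 < q)).
Proof.
rewrite is_sinkE /= !(mul1r, mulN1r, opprK) => /and5P [p0 s0 q0 _ _] dt.
case: (ltrgtP `|p| `|s|) => h.
- have [-> [-> [-> ->]]] : (s == - p) = false /\ ((s == p) = false /\ ((p == - s) = false
  /\ (p == s) = false)) by lia.
  by rewrite /= !orbF; clear dt; lia.
- have [-> [-> [-> ->]]] : (s == - p) = false /\ ((s == p) = false /\ ((p == - s) = false
  /\ (p == s) = false)) by lia.
  by rewrite /= !orbF; clear dt; lia.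
have [E|E] : s = p \/ s = - p by lia.
  have qt : q != t by apply: contra_neq dt => ->; rewrite E; ring.
  have [-> [-> [-> ->]]] : (s == - p) = false /\ ((s == p) = true /\ ((p == - s) = false
    /\ (p == s) = true)) by lia.
  by rewrite /=; clear -q0 qt; lia.
have qt : q != - t by apply: contra_neq dt => ->; rewrite E; ring.
have [-> [-> [-> ->]]] : (s == - p) = true /\ ((s == p) = false /\ ((p == - s) = true
  /\ (p == s) = false)) by lia.
by rewrite /=; clear -q0 qt; lia.
Qed.

(* Signed Hermite normal forms: d and e on the diagonal, k modulo e. *)
Definition residues (M R : nat) : nat :=
  count (fun v : int * int * int => (`|v.1.1 * v.1.2| == M%:Z)
    && (0 <= v.2 < `|v.1.2|)) (box (box (irange R) R) R).

Lemma sum_irange_even R (F : int -> int) : (forall x, F (- x) = F x) -> F 0 = 0 ->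
  \sum_(x <- irange R) F x = 2 * \sum_(x <- irange R | 0 < x) F x.
Proof.
move=> FN F0; have E : \sum_(x <- irange R | x < 0) F x = \sum_(x <- irange R | 0 < x) F x.
  have pr : perm_eq (map -%R (irange R)) (irange R).
    apply: uniq_perm; rewrite ?(map_inj_uniq oppr_inj) ?irange_uniq // => x.
    by rewrite -{1}(opprK x) (mem_map oppr_inj) !mem_irange normrN.
  by rewrite -[LHS](perm_big _ pr) [LHS]big_map; apply: eq_big => [x|x _]; rewrite ?oppr_lt0.
rewrite (bigID (fun x => 0 < x)) /= mulr_natl mulr2n; congr (_ + _); rewrite -E.
rewrite (bigID (fun x => x == 0)) /= [X in X + _]big1 => [|x /andP[_ /eqP ->] //]; rewrite add0r.
by apply: eq_bigl => x; lia.
Qed.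

Lemma count_nat R (m : int) : `|m| <= R%:Z -> (count (fun k => 0 <= k < `|m|)
  (irange R))%:Z = `|m|.
Proof.
move=> mR; rewrite -[in RHS]abszE; congr Posz; rewrite -[RHS](size_iota 0) -count_predT.
apply: (count_bij _ _ _ _ _ _ absz Posz) => [||x|y]; rewrite ?irange_uniq ?iota_uniq //.
  by rewrite mem_irange mem_iota => ? ?; split => //; lia.
by rewrite mem_irange mem_iota => ? ?; split => //; lia.
Qed.

(** Each e has |e| residues, and each positive factorisation of M has four choices of signs;
    exchanging d and e gives the divisor sum. *)
Lemma residuesE M R : (0 < M)%N -> (M <= R)%N -> (residues M R)%:Z = 4 * divisor_sum R M.
Proof.
move=> M0 MR.
have -> : (residues M R)%:Z = \sum_(d <- irange R) \sum_(e <- irange R) (if `|d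
  * e| == M%:Z then `|e| else 0).
  rewrite /residues -sum1_count -[LHS]natz natr_sum [LHS]big_mkcond !big_box.
  apply: eq_bigr => d _; rewrite big_seq [RHS]big_seq; apply: eq_bigr => e;
    rewrite mem_irange => eR.
  case: ifP => E; last by rewrite big1 // => k _; rewrite /= E.
  by rewrite -[RHS](count_nat R e eR) -sum1_count -[RHS]natz natr_sum [RHS]big_mkcond;
    apply: eq_bigr => k _; rewrite /= ?E.
rewrite (sum_irange_even _ (fun d => \sum_(e <- irange R) (if `|d
  * e| == M%:Z then `|e| else 0))); first last.
- by apply: big1 => e _; rewrite mul0r normr0; case: eqP => //; lia.
- by move=> d; apply: eq_bigr => e _; rewrite mulNr normrN.
rewrite (_ : 4 = 2 * 2) // -mulrA; congr (2 * _).
have -> : divisor_sum R M = \sum_(d <- irange R) \sum_(e <- irange R |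
  [&& 0 < d, 0 < e & d * e == M%:Z]) e.
  rewrite /divisor_sum; under eq_bigr => d _ do rewrite big_mkcond; rewrite exchange_big.
  apply: eq_bigr => d _; rewrite [RHS]big_mkcond; apply: eq_bigr => e _.
  by rewrite (mulrC e) andbCA.
rewrite mulr_sumr big_mkcond; apply: eq_bigr => d _; case: ifP => d0; last by rewrite big1 ?mulr0.
rewrite sum_irange_even; first last.
- by rewrite mulr0 normr0; case: eqP => //; lia.
- by move=> e; rewrite mulrN !normrN.
congr (2 * _); rewrite big_mkcond [RHS]big_mkcond; apply: eq_bigr => e _; case: ifP => //= e0.
by rewrite !gtr0_norm ?mulr_gt0.
Qed.

Lemma eq_or_opp_norm (x y : int) (M : nat) :
  (x * y == M%:Z) || (x * y == - M%:Z) = (`|x * y| == M%:Z).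
Proof. by lia. Qed.

Lemma norm_factor_le (x y : int) (M : nat) :
  (0 < M)%N -> `|x * y| = M%:Z -> `|x| <= M%:Z /\ `|y| <= M%:Z.
Proof.
rewrite normrM => M0; move: (normr_ge0 x) (normr_ge0 y); move: `|x| `|y| => a b ? ? E.
have a0 : a != 0 by apply: contraTneq M0 => a0; move: E; rewrite a0 mul0r; lia.
have b0 : b != 0 by apply: contraTneq M0 => b0; move: E; rewrite b0 mulr0; lia.
rewrite -E; split; nia.
Qed.

(** At a sink s = p or s = - p, and the determinant is p (q - t) or p (q + t). Let d = p, let |e| be
    the size of the second factor, and let the sign of e tell s = p from s = - p. The sign rules
    determine q from t and put t between - |e| and |e|; the |e| even values there are numbered by
    k. *)
Lemma count_euclid_sinks_classA M R : odd M -> (3 * M <= R)%N ->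
  count (is_sink euclid_flow) (states (classA M) R) = residues M R.
Proof.
move=> oM MR; have M0 : (0 < M)%N by lia.
pose h (v : state) : int * int * int := let: (p, s, t, q) := v in
  let e := if s == p then `|q - t| else - `|q + t| in (p, e, ((t + `|e| - 1) %/ 2)%Z).
pose h' (v : int * int * int) : state := let: (d, e, k) := v in
  let t := 2 * k - (`|e| - 1) in let z := if t < 0 then t + `|e| else t - `|e| in
  if 0 < e then (d, d, t, z) else (d, - d, t, - z).
apply: (count_bij _ _ _ _ _ _ h h'); rewrite ?states_uniq ?box_uniq ?irange_uniq //.
- move=> [[[p s] t] q]; rewrite mem_states => /and5P [cA pR sR tR qR].
  have [nd dt _] := classA_admissible M oM _ cA.
  rewrite euclid_sinkE //; last by move: dt; clear -M0; move: (det _) => ?; lia.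
  move: cA => /and5P [+ + + + _]; rewrite /oddz /evenz => op os et oq sk.
  have [Es|Es] : s = p \/ s = - p by lia.
    have D : `|p * (q - t)| = M%:Z.
      by apply/eqP; rewrite -eq_or_opp_norm; move: dt; rewrite /det Es mulrBr.
    have [? ?] := norm_factor_le _ _ _ M0 D.
    have D2 : `|p * `|q - t| | = M%:Z by rewrite -D !normrM; congr (_ * _); lia.
    have N2 : `| `|q - t| | = `|q - t| by lia.
    rewrite /h Es eqxx !mem_box mem_irange /= D2 N2 eqxx; clear D D2 dt nd h.
    have [T1 T2] : 2 * ((t + `|q - t| - 1) %/ 2)%Z = t + `|q - t| - 1 /\ 0 < `|q - t|
      by clear -oq et sk; lia.
    split; [lia|lia|]; rewrite /h' ?N2 T1 T2 (_ : _ - _ - (_ - _) = t); last by ring.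
    by case: ifP => ?; repeat congr pair; lia.
  have D : `|p * (q + t)| = M%:Z.
    apply/eqP; rewrite -eq_or_opp_norm; move: dt;
      rewrite /det Es. rewrite (_ : p * q - - p * t = p * (q + t)) //; ring.
  have [? ?] := norm_factor_le _ _ _ M0 D.
  have sp : (s == p) = false by lia.
  have D2 : `|p * - `|q + t| | = M%:Z by rewrite -D !normrM; congr (_ * _); lia.
  have N2 : `|- `|q + t| | = `|q + t| by lia.
  rewrite /h sp !mem_box mem_irange /= D2 N2 eqxx; clear D D2 dt nd h.
  have [T1 T2] : 2 * ((t + `|q + t| - 1) %/ 2)%Z = t + `|q + t| - 1
    /\ (0 < - `|q + t|) = false by clear -oq et sk; lia.
  split; [lia|lia|]; rewrite /h' ?N2 T1 T2 (_ : _ - _ - (_ - _) = t); last by ring.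
  by case: ifP => ?; repeat congr pair; lia.
move=> [[d e] k]; rewrite !mem_box mem_irange -andbA /= => /and3P[dR eR kR] /andP[/eqP D ke].
have [a b] := norm_factor_le _ _ _ M0 D.
have /andP [od oe] : ((d %% 2)%Z == 1) && ((e %% 2)%Z == 1).
  by rewrite -odd_mulz; clear -D oM; lia.
rewrite /h'.
set t := 2 * k - (`|e| - 1); set z := if t < 0 then _ else _.
have [zt1 [zt2 [zt3 [zt4 [zt5 zt6]]]]] : `|z - t| = `|e| /\ (`|z| <= 2 * `|e|
  /\ (`|t| <= `|e| /\ ((t < 0) = (0 < z) /\ ((t %% 2)%Z == 0 /\ (z %% 2)%Z == 1)))).
  by rewrite /z; case: ifP; rewrite /t; clear -ke oe; lia.
have k1 : ((t + `|e| - 1) %/ 2)%Z = k by rewrite /t; clear; lia.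
have [e0|e0] := ltrP 0 e.
  have D2 : `|det (d, d, t, z)| = M%:Z by rewrite /det -mulrBr normrM zt1 -normrM.
  have cA : classA M (d, d, t, z) by rewrite /classA /oddz /evenz od zt5 zt6 /=; move: D2;
    rewrite /det; clear; lia.
  have [nd dt _] := classA_admissible M oM _ cA.
  rewrite mem_states cA euclid_sinkE //; last by move: D2; clear -M0; move: (det _) => ?; lia.
  split; [clear -MR zt1 zt2 zt3 e0 dR a b; lia| |rewrite /h eqxx].
    by clear -zt4 zt6; lia.
  have -> : `|z - t| = e by lia.
  by rewrite k1.
have D2 : `|det (d, - d, t, - z)| = M%:Z.
  by rewrite /det mulNr opprK mulrN addrC -mulrBr normrM distrC zt1 -normrM.
have cA : classA M (d, - d, t, - z).
  by rewrite /classA /oddz /evenz od zt5 /=; move: D2 zt6 od; rewrite /det; clear; lia.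
have [nd dt _] := classA_admissible M oM _ cA.
rewrite mem_states cA euclid_sinkE //; last by move: D2; clear -M0; move: (det _) => ?; lia.
split; [clear -MR zt1 zt2 zt3 e0 dR a b; lia| |rewrite /h].
  by clear -zt4 zt6; lia.
have -> : (- d == d) = false by clear -od; lia.
have -> : - `|- z + t| = e by clear -zt1 e0; lia.
by rewrite k1.
Qed.

(** As before, but the second factor of the determinant is twice an odd number of size |e|, and t
    lies between - 2 |e| and 2 |e| in the class of - s modulo 4, which again leaves |e| values. *)
Lemma count_euclid_sinks_classB M R : odd M -> (6 * M <= R)%N ->
  count (is_sink euclid_flow) (states (classB M) R) = residues M R.
Proof.
move=> oM MR; have M0 : (0 < M)%N by lia.
pose h (v : state) : int * int * int := let: (p, s, t, q) := v in
  let e := if s == p then ((q - t) %/ 2)%Z else ((q + t) %/ 2)%Z in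
  (p, if s == p then `|e| else - `|e|, ((t + 2 * `|e| - (s %% 4)%Z) %/ 4)%Z).
pose h' (v : int * int * int) : state := let: (d, e, k) := v in
  let s := if 0 < e then d else - d in
  let t := 4 * k + (s %% 4)%Z - 2 * `|e| in
  let z := if t < 0 then t + 2 * `|e| else t - 2 * `|e| in
  (d, s, t, if 0 < e then z else - z).
apply: (count_bij _ _ _ _ _ _ h h'); rewrite ?states_uniq ?box_uniq ?irange_uniq //.
- move=> [[[p s] t] q]; rewrite mem_states => /and5P [cA pR sR tR qR].
  have [nd dt _] := classB_admissible M oM _ cA.
  rewrite euclid_sinkE //; last by move: dt; clear -M0; move: (det _) => ?; lia.
  move: cA => /and5P [+ + + + /andP[+ _]]; rewrite /oddz => op os ot oq st sk.
  have [Es|Es] : s = p \/ s = - p by lia.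
    have [w Ew] : exists w, q - t = 2 * w by exists ((q - t) %/ 2)%Z; clear -ot oq; lia.
    have D : `|p * w| = M%:Z.
      have : det (p, s, t, q) = 2 * (p * w) by rewrite mulrCA -Ew /det Es; ring.
      by move: dt => + Ed; rewrite Ed; clear; lia.
    have [pM wM] := norm_factor_le _ _ _ M0 D.
    have /andP [_ ow] : ((p %% 2)%Z == 1) && ((w %% 2)%Z == 1) by rewrite -odd_mulz;
      clear -D oM; lia.
    have D2 : `|p * `|w| | = M%:Z by rewrite -D !normrM; congr (_ * _); lia.
    have w2 : ((2 * w) %/ 2)%Z = w by clear; lia.
    rewrite /h Es eqxx Ew w2 !mem_box mem_irange /= D2 eqxx; rewrite Es in st; clear D D2 dt nd h.
    have T1 : 4 * ((t + 2 * `|w| - (p %% 4)%Z) %/ 4)%Z = t + 2 * `|w| - (p %% 4)%Z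
      by clear -ow ot op st; lia.
    have w0 : 0 < `|w| by clear -ow; lia.
    have nw : `| `|w| | = `|w| by lia.
    have tw : - (2 * `|w|) < t < 2 * `|w| by clear -sk Ew Es op; lia.
    split; [clear -pR MR tw w0 wM; lia|clear -nw tw w0 T1 op; lia|].
    rewrite /h' nw w0 T1 (_ : _ + _ - _ = t); last by ring.
    by case: ifP => tt; repeat congr pair; clear -Ew sk Es op tt; lia.
  have [w Ew] : exists w, q + t = 2 * w by exists ((q + t) %/ 2)%Z; clear -ot oq; lia.
  have D : `|p * w| = M%:Z.
    have : det (p, s, t, q) = 2 * (p * w) by rewrite mulrCA -Ew /det Es; ring.
    by move: dt => + Ed; rewrite Ed; clear; lia.
  have [pM wM] := norm_factor_le _ _ _ M0 D.
  have /andP [_ ow] : ((p %% 2)%Z == 1) && ((w %% 2)%Z == 1) by rewrite -odd_mulz;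
    clear -D oM; lia.
  have D2 : `|p * - `|w| | = M%:Z by rewrite -D !normrM; congr (_ * _); lia.
  have w2 : ((2 * w) %/ 2)%Z = w by clear; lia.
  have sp : (s == p) = false by clear -Es op; lia.
  rewrite /h sp Ew w2 !mem_box mem_irange /= D2 eqxx; clear D D2 dt nd h.
  have T1 : 4 * ((t + 2 * `|w| - (s %% 4)%Z) %/ 4)%Z = t + 2 * `|w| - (s %% 4)%Z
    by clear -ow ot os st; lia.
  have w0 : (0 < - `|w|) = false by clear -ow; lia.
  have nw : `|- `|w| | = `|w| by lia.
  have tw : - (2 * `|w|) < t < 2 * `|w| by clear -sk Ew Es op; lia.
  have ww : 0 < `|w| by clear -ow; lia.
  split; [clear -pR MR tw ww wM; lia|clear -nw tw ww T1 os; lia|].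
  rewrite /h' nw w0 -Es T1 (_ : _ + _ - _ = t); last by ring.
  by case: ifP => tt; repeat congr pair; clear -Ew sk Es op tt; lia.
move=> [[d e] k]; rewrite !mem_box mem_irange -andbA /= => /and3P[dR eR kR] /andP[/eqP D ke].
have [a b] := norm_factor_le _ _ _ M0 D.
have /andP [od oe] : ((d %% 2)%Z == 1) && ((e %% 2)%Z == 1).
  by rewrite -odd_mulz; clear -D oM; lia.
rewrite /h'; set s := if 0 < e then d else - d.
set t := 4 * k + (s %% 4)%Z - 2 * `|e|; set z := if t < 0 then _ else _.
have os : (s %% 2)%Z == 1 by rewrite /s; case: ifP => _; clear -od; lia.
have [zt1 [zt2 [zt3 [zt4 [zt5 zt6]]]]] : `|z - t| = 2 * `|e| /\ (`|z| <= 4 * `|e|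
  /\ (`|t| <= 2 * `|e| /\ ((t < 0) = (0 < z) /\ (((s + t) %% 4)%Z == 0 /\ (z %% 2)%Z == 1)))).
  by rewrite /z; case: ifP; rewrite /t; clear -ke oe os; lia.
have k1 : ((t + 2 * `|e| - (s %% 4)%Z) %/ 4)%Z = k by rewrite /t; clear; lia.
have ot : (t %% 2)%Z == 1 by clear -zt5 os; lia.
have [e0|e0] := ltrP 0 e.
  have Es : s = d by rewrite /s e0.
  rewrite Es in zt5 k1 *.
  have D2 : `|det (d, d, t, z)| = (2 * M)%N%:Z
    by rewrite /det -mulrBr normrM zt1 mulrCA -normrM D.
  have cA : classB M (d, d, t, z) by rewrite /classB /oddz od ot zt5 zt6 /=; move: D2;
    rewrite /det; clear; lia.
  have [nd dt _] := classB_admissible M oM _ cA.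
  rewrite mem_states cA euclid_sinkE //; last by move: D2; clear -M0; move: (det _) => ?; lia.
  split; [clear -MR zt1 zt2 zt3 e0 dR a b; lia| |rewrite /h eqxx].
    by clear -zt4 zt6; lia.
  have -> : `|((z - t) %/ 2)%Z| = e by clear -zt1 e0; lia.
  by move: k1; rewrite gtr0_norm // => ->.
have Es : s = - d by rewrite /s ltNge e0.
rewrite Es in zt5 k1 *.
have D2 : `|det (d, - d, t, - z)| = (2 * M)%N%:Z.
  by rewrite /det mulNr opprK mulrN addrC -mulrBr normrM distrC zt1 mulrCA -normrM D.
have cA : classB M (d, - d, t, - z).
  by rewrite /classB /oddz od zt5 /=; move: D2 ot zt6 od; rewrite /det; clear; lia.
have [nd dt _] := classB_admissible M oM _ cA.
rewrite mem_states cA euclid_sinkE //; last by move: D2; clear -M0; move: (det _) => ?; lia.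
split; [clear -MR zt1 zt2 zt3 e0 dR a b; lia| |rewrite /h].
  by clear -zt4 zt6; lia.
have -> : (- d == d) = false by clear -od; lia.
have -> : `|((- z + t) %/ 2)%Z| = - e by clear -zt1 e0; lia.
by move: k1; rewrite opprK ler0_norm // => ->.
Qed.

Lemma sum_count_box (T : Type) (P : pred int) (Q : int -> pred T) s R :
  (\sum_(y <- irange R | P y) count (Q y) s =
    count (fun v : T * int => P v.2 && Q v.2 v.1) (box s R))%N.
Proof.
rewrite -[RHS]sum1_count [RHS]big_mkcond big_box exchange_big big_mkcond.
apply: eq_bigr => y _; case: (P y); last by rewrite big1.
by rewrite -sum1_count big_mkcond.
Qed.

Lemma sqr_normM (x : int) : x ^+ 2 = `|x| * `|x|.
Proof. by rewrite -expr2 real_normK ?num_real. Qed.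

(** * Reduced forms as sinks of the first orientation *)

Definition formA (N : int) (v : int * int * int) : bool := let: (p, q, b) := v in
  [&& 0 < p, 0 < q, oddz p, oddz q & [&& oddz b, `|b| < 2 * p, `|b| < 2 * q & 4 * (p
    * q) - b ^+ 2 == N]].

Definition formB (N : int) (v : int * int * int) : bool := let: (p, q, c) := v in
  [&& 0 < p, 0 < q, oddz p, oddz q & [&& evenz c, `|c| < p, `|c| < q & p * q - c ^+ 2 == N]].

Definition num_forms (f : int -> pred (int * int * int)) (R : nat) (N : int) : nat :=
  count (f N) (box (box (irange R) R) R).

(** The bounds on b give 4 p q - b^2 >= 2 p + 2 q - 1, so the forms that are counted lie in a box
    depending on M only. *)
Lemma formA_bound p q b y (M : nat) : formA (4 * M%:Z - y ^+ 2) (p, q, b) ->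
  p + q <= 2 * M%:Z /\ `|y| <= 2 * M%:Z.
Proof.
case/and5P=> p0 q0 _ _ /and4P[_ bp bq /eqP E].
have h : b ^+ 2 <= (2 * p - 1) * (2 * q - 1) by rewrite sqr_normM; nia.
have y0 : 0 <= y ^+ 2 by rewrite sqr_ge0.
have hy := sqr_normM y.
have h2 : (2 * p - 1) * (2 * q - 1) = 4 * (p * q) - 2 * p - 2 * q + 1 by ring.
split; [lia|nia].
Qed.

Lemma formB_bound p q c y (M : nat) : formB (2 * M%:Z - y ^+ 2) (p, q, c) ->
  [/\ p <= 2 * M%:Z, q <= 2 * M%:Z & `|y| <= 2 * M%:Z].
Proof.
case/and5P=> p0 q0 _ _ /and4P[_ bp bq /eqP E].
have h : c ^+ 2 <= (p - 1) * (q - 1) by rewrite sqr_normM; nia.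
have y0 : 0 <= y ^+ 2 by rewrite sqr_ge0.
have hy := sqr_normM y.
have h2 : (p - 1) * (q - 1) = p * q - p - q + 1 by ring.
split; [lia|lia|nia].
Qed.

(** A form with y gives s = (b + y) / 2 and t = (b - y) / 2, exactly one of which is odd. If it is
    t, the matrix is transposed and negated: the sinks with p < 0 encode this case. *)
Lemma count_reduction_sinks_classA M R : odd M -> (3 * M <= R)%N ->
  (count (is_sink reduction_flow) (states (classA M) R) =
    \sum_(y <- irange R | oddz y) num_forms formA R (4 * M%:Z - y ^+ 2))%N.
Proof.
move=> oM MR; have M0 : (0 < M)%N by lia.
rewrite sum_count_box.
pose h (v : state) : int * int * int * int := let: (p, s, t, q) := v in
  if 0 < p then (p, q, s + t, s - t) else (- p, - q, - s - t, s - t).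
pose h' (v : int * int * int * int) : state := let: (p, q, b, y) := v in
  if oddz ((b + y) %/ 2)%Z then (p, ((b + y) %/ 2)%Z, ((b - y) %/ 2)%Z, q)
  else (- p, ((y - b) %/ 2)%Z, - ((b + y) %/ 2)%Z, - q).
have quad (p s t q : int) : 4 * (p * q) - (s + t) ^+ 2 =
  4 * (p * q - s * t) - (s - t) ^+ 2 by ring.
apply: (count_bij _ _ _ _ _ _ h h'); rewrite ?states_uniq ?box_uniq ?irange_uniq //.
- move=> [[[p s] t] q]; rewrite mem_states => /and5P [cA pR sR tR qR].
  have [nd dt _] := classA_admissible M oM _ cA.
  rewrite reduction_sinkE //.
  move: cA => /and5P [+ + + + _]; rewrite /oddz /evenz => op os et oq /and3P[pq sp sq].
  (* A sink has (s + t)^2 <= 4 p q, which excludes the determinant - M. *)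
  have dM : p * q - s * t = M%:Z.
    have /orP [/eqP //|/eqP E] := dt; exfalso; rewrite /det in E.
    have := quad p s t q; rewrite E.
    have hy : 0 <= (s - t) ^+ 2 by rewrite sqr_ge0.
    have : (s + t) ^+ 2 <= 4 * (p * q); last by lia.
    rewrite sqr_normM.
    have -> : p * q = `|p| * `|q|.
      clear -pq; case: (ltrP p 0) pq => p0; case: (ltrP q 0) => q0 // _;
        first by rewrite !ltr0_norm // mulrNN.
      by rewrite !ger0_norm.
    have -> : 4 * (`|p| * `|q|) = (2 * `|p|) * (2 * `|q|) by ring.
    by apply: ler_pM => //; lia.
  have Eq := quad p s t q; rewrite dM in Eq.
  have q0 : q != 0 by clear -oq; lia.
  clear dt; have [p0|p0] := ltrP 0 p.
    have f : formA (4 * M%:Z - (s - t) ^+ 2) (p, q, s + t).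
      by rewrite /formA /oddz Eq eqxx op oq; clear -op oq p0 pq sp sq os et; lia.
    have [pM yM] := formA_bound _ _ _ _ _ f.
    rewrite /h p0; split; [rewrite !mem_box mem_irange; clear -pM yM p0 q0 pq sp sq MR;
      lia|apply/andP; split; [rewrite /oddz /=; clear -os et; lia|exact: f]|].
    rewrite /h'; have -> : ((s + t + (s - t)) %/ 2)%Z = s by clear; lia.
    by rewrite /oddz os; repeat congr pair; clear; lia.
  have f : formA (4 * M%:Z - (s - t) ^+ 2) (- p, - q, - s - t).
    rewrite /formA /oddz mulrNN -(opprD s t) sqrrN Eq eqxx; clear -op oq p0 pq sp sq os et; lia.
  have [pM yM] := formA_bound _ _ _ _ _ f.
  have -> : h (p, s, t, q) = (- p, - q, - s - t, s - t) by rewrite /h ltNge p0.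
  split; [rewrite !mem_box mem_irange; clear -pM yM p0 q0 pq sp sq MR; lia|apply/andP; split;
    [rewrite /oddz /=; clear -os et; lia|exact: f]|].
  rewrite /h'; have -> : ((- s - t + (s - t)) %/ 2)%Z = - t by clear; lia.
  have -> : oddz (- t) = false by rewrite /oddz; clear -et; lia.
  by repeat congr pair; clear; lia.
move=> [[[p q] b] y]; rewrite !mem_box mem_irange => _ /andP [/= oy f].
have [pM yM] := formA_bound _ _ _ _ _ f.
move: f => /and5P[p0 q0 op oq /and4P[ob bp bq /eqP E]].
rewrite /oddz in op oq oy ob; rewrite /h'.
have [s [t [Eb Ey]]] : exists s t, b = s + t /\ y = s - t.
  by exists ((b + y) %/ 2)%Z, ((b - y) %/ 2)%Z; clear -ob oy; lia.
have -> : ((b + y) %/ 2)%Z = s by clear -Eb Ey; lia.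
have -> : ((b - y) %/ 2)%Z = t by clear -Eb Ey; lia.
have -> : ((y - b) %/ 2)%Z = - t by clear -Eb Ey; lia.
have dM : p * q - s * t = M%:Z by have := quad p s t q; rewrite -Eb -Ey E; clear; lia.
rewrite /oddz; case: ifP => os.
  have cA : classA M (p, s, t, q).
    by rewrite /classA /det dM eqxx /oddz /evenz op oq os; clear -os ob Eb; lia.
  have [nd _ _] := classA_admissible M oM _ cA.
  rewrite mem_states cA reduction_sinkE // /h p0; split; [clear -MR bp bq Eb Ey yM pM p0 q0;
    lia|clear -bp bq p0 q0 Eb; lia|].
  by rewrite Eb Ey.
have cA : classA M (- p, - t, - s, - q).
  rewrite /classA /det !mulrNN (mulrC t) dM eqxx /oddz /evenz; clear -os ob Eb op oq; lia.
have [nd _ _] := classA_admissible M oM _ cA.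
have hh : h (- p, - t, - s, - q) = (p, q, b, y).
  have pn : (0 < - p) = false by clear -p0; lia.
  by rewrite /h pn; repeat congr pair; clear -Eb Ey; lia.
rewrite mem_states cA reduction_sinkE // hh; split => //.
  by clear -MR bp bq Eb Ey yM pM p0 q0; lia.
by clear -bp bq p0 q0 Eb; lia.
Qed.

Definition opp_state (v : state) : state := let: (p, s, t, q) := v in (- p, - s, - t, - q).

Lemma count_reduction_sinks_classB M R : odd M -> (6 * M <= R)%N ->
  (count (is_sink reduction_flow) (states (classB M) R) =
    2 * \sum_(x <- irange R | oddz x) num_forms formB R (2 * M%:Z - x ^+ 2))%N.
Proof.
move=> oM MR; have M0 : (0 < M)%N by lia.
rewrite sum_count_box (count_split _ _ (fun v : state => 0 < v.1.1.1)).
set S := box _ R; set P := fun v : int * int * int * int => _.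
have sinkE p s t q : (p, s, t, q) \in states (classB M) R -> is_sink reduction_flow (p, s, t, q) =
    [&& (p < 0) == (q < 0), `|s + t| < 2 * `|p| & `|s + t| < 2 * `|q|].
  rewrite mem_filter => /andP[cA _]; have [nd _ _] := classB_admissible M oM _ cA.
  exact: reduction_sinkE.
(* Negating the matrix exchanges the sinks with p > 0 and those with p < 0, whence the factor 2. *)
have E1 : count (fun v : state => is_sink reduction_flow v
  && ~~ (0 < v.1.1.1)) (states (classB M) R) =
          count (fun v : state => is_sink reduction_flow v
            && (0 < v.1.1.1)) (states (classB M) R).
  have oppS (v : state) : v \in states (classB M) R -> [/\ opp_state v \in states (classB M) R,
     is_sink reduction_flow (opp_state v) =
       is_sink reduction_flow v, opp_state (opp_state v) = v & (0 < (opp_state v).1.1.1) =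
       ~~ (0 < v.1.1.1)].
    case: v => [[[p s] t] q] vS; have H : opp_state (p, s, t, q) \in states (classB M) R.
      move: vS; rewrite !mem_states !normrN /classB /det /oddz !mulrNN => /andP[/and5P[h1 h2
        h3 h4 /andP[h5 ->]] ->].
      by rewrite !andbT; clear -h1 h2 h3 h4 h5; lia.
    have p0 : p != 0 by move: vS; rewrite mem_states => /andP [/andP [op _] _]; move: op;
      rewrite /oddz; clear; lia.
    split; rewrite ?H // ?(sinkE _ _ _ _ vS) ?(sinkE _ _ _ _ H).
    + have q0 : q != 0 by move: vS; rewrite mem_states => /andP [/and5P [_ _ _ op _] _];
      move: op; rewrite /oddz; clear; lia.
      rewrite -(opprD s t) !normrN; congr (_ && _); clear -p0 q0; lia.
    + by rewrite /= !opprK.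
    + by rewrite /=; clear -p0; lia.
  apply: (count_bij _ _ _ _ _ _ opp_state opp_state); rewrite ?states_uniq // => v vS.
    by have [? -> ? ->] := oppS v vS.
  by have [? -> ? ->] := oppS v vS; rewrite negbK.
rewrite E1 addnn -mul2n; congr (2 * _)%N.
pose h (v : state) : int * int * int * int := let: (p, s, t, q) := v in
  (p, q, ((s + t) %/ 2)%Z, ((s - t) %/ 2)%Z).
pose h' (v : int * int * int * int) : state := let: (p, q, c, x) := v in
  (p, c + x, c - x, q).
have quad (p q c x : int) : p * q - c ^+ 2 = (p * q - (c + x) * (c - x)) - x ^+ 2 by ring.
apply: (count_bij _ _ _ _ _ _ h h'); rewrite ?states_uniq ?box_uniq ?irange_uniq //.
- move=> [[[p s] t] q] vS; rewrite sinkE //.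
  move: vS; rewrite mem_states => /and5P [cA pR sR tR qR].
  have [nd dt _] := classB_admissible M oM _ cA.
  move: cA => /and5P [+ + + + /andP[+ _]];
    rewrite /oddz => op os et oq st /andP[/and3P[pq sp sq] p0]; rewrite /= in p0.
  have q0 : 0 < q by clear -p0 pq oq; lia.
  have [c [x [Ec Ex]]] : exists c x, s = c + x /\ t = c - x.
    by exists ((s + t) %/ 2)%Z, ((s - t) %/ 2)%Z; clear -os et; lia.
  have dM : p * q - s * t = 2 * M%:Z.
    have /orP [/eqP E|/eqP E] := dt; rewrite /det in E; first by rewrite E; clear; lia.
    exfalso; have := quad p q c x; rewrite -Ec -Ex E.
    have hy : 0 <= x ^+ 2 by rewrite sqr_ge0.
    have : c ^+ 2 <= p * q; last by lia.
    rewrite sqr_normM; apply: ler_pM => //; clear -sp sq p0 q0 Ec Ex; lia.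
  have Eq := quad p q c x; rewrite -Ec -Ex dM in Eq.
  have hh : h (p, s, t, q) = (p, q, c, x) by rewrite /h; repeat congr pair; clear -Ec Ex; lia.
  have f : formB (2 * M%:Z - x ^+ 2) (p, q, c).
    by rewrite /formB /oddz /evenz Eq eqxx p0 q0 op oq; clear -p0 q0 Ec Ex st sp sq; lia.
  have [pM qM yM] := formB_bound _ _ _ _ _ f.
  rewrite hh; split; [rewrite !mem_box mem_irange; clear -pM qM yM p0 q0 sp Ec Ex MR;
    lia|apply/andP; split; [rewrite /oddz /=; clear -os st Ec Ex; lia|exact: f]|].
  by rewrite /h' -Ec -Ex.
move=> [[[p q] c] x]; rewrite !mem_box mem_irange => _ /andP [/= oy f].
have [pM qM yM] := formB_bound _ _ _ _ _ f.
move: f => /and5P[p0 q0 op oq /and4P[ob bp bq /eqP E]].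
rewrite /oddz /evenz in op oq oy ob.
have dM : p * q - (c + x) * (c - x) = (2 * M)%N%:Z by have := quad p q c x; rewrite E; clear; lia.
have cA : classB M (p, c + x, c - x, q).
  by rewrite /classB /det dM eqxx /oddz op oq; clear -ob oy; lia.
have vS : (p, c + x, c - x, q) \in states (classB M) R.
  by rewrite mem_states cA; clear -MR bp bq yM pM qM p0 q0; lia.
rewrite /h' sinkE //; split=> //; first by clear -bp bq p0 q0; rewrite /=; lia.
by rewrite /h; repeat congr pair; clear; lia.
Qed.

(** * Three squares *)

(** The system is triangular: x = 1 and x = -1 contribute 2 [c N], and the other odd x refer to
    smaller indices. The bound on R leaves room for the boxes, which need 3 K <= R with K up to N +
    1. *)
Lemma deconvolution (R : nat) (good : pred nat) (c : nat -> int) :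
  (forall N x, good N -> oddz x -> (absz x ^ 2 <= N.+1)%N -> good (N.+1 - absz x ^ 2)%N) ->
  (forall N, good N -> (3 * N.+1 < R)%N ->
     \sum_(x <- irange R | oddz x && (absz x ^ 2 <= N.+1)%N) c (N.+1 - absz x ^ 2)%N = 0) ->
  forall N, good N -> (3 * N.+1 < R)%N -> c N = 0.
Proof.
move=> gd H; elim/ltn_ind => N IH gN NR; have := H N gN NR.
rewrite big_mkcond sum_irange_pm1; [|lia|].
  by rewrite /= subn1 /= => /eqP; rewrite -mulr2n mulrn_eq0 => /eqP.
move=> x _ x1 xm1; case: ifP => // /andP[ox xN].
have x3 : (3 <= absz x)%N by move: ox; rewrite /oddz; lia.
have x9 : (3 ^ 2 <= absz x ^ 2)%N by rewrite leq_exp2r.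
apply: IH; [lia|exact: gd|lia].
Qed.

Lemma formA_gt0 N v : formA N v -> 0 < N.
Proof.
case: v => [[p q] b] /and5P[p0 q0 _ _ /and4P[_ bp bq /eqP <-]].
have h : b ^+ 2 <= (2 * p - 1) * (2 * q - 1) by rewrite sqr_normM; nia.
have h2 : (2 * p - 1) * (2 * q - 1) = 4 * (p * q) - 2 * p - 2 * q + 1 by ring.
lia.
Qed.

Lemma formB_gt0 N v : formB N v -> 0 < N.
Proof.
case: v => [[p q] b] /and5P[p0 q0 _ _ /and4P[_ bp bq /eqP <-]].
have h : b ^+ 2 <= (p - 1) * (q - 1) by rewrite sqr_normM; nia.
have h2 : (p - 1) * (q - 1) = p * q - p - q + 1 by ring.
lia.
Qed.

(** Since only positive numbers are represented, the terms with x^2 > L vanish, and the subtraction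
    can be made in [nat]. *)
Lemma sum_num_forms (f : int -> pred (int * int * int)) (R L : nat) :
  (forall N v, f N v -> 0 < N) ->
  (\sum_(x <- irange R | oddz x) num_forms f R (L%:Z - x ^+ 2))%N%:Z =
  \sum_(x <- irange R | oddz x && (absz x ^ 2 <= L)%N) (num_forms f R (L - absz x ^ 2)%N%:Z)%:Z.
Proof.
move=> fpos; rewrite -[LHS]natz natr_sum [RHS]big_mkcondr; apply: eq_bigr => x _.
have xx := sqr_absz x; rewrite natz; case: leqP => xL.
  by congr (num_forms _ _ _)%:Z; lia.
rewrite /num_forms (eq_count (a2 := pred0)) ?count_pred0 // => v.
by apply/negP => /fpos; lia.
Qed.

Lemma count_sinks_reduction_euclid D K R : admissible D K -> (3 * K <= R)%N -> (0 < K)%N ->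
  count (is_sink reduction_flow) (states D R) = count (is_sink euclid_flow) (states D R).
Proof.
move=> ad K3 K0; apply: (count_sinks_eq _ _ _ flip) => [|j v _||];
  [exact: states_uniq|exact: flipK| |].
- split=> [j v|j v|i j v].
  + exact: reduction_flow_states ad K3 K0.
  + by rewrite mem_filter => /andP[cv _] _; apply: reduction_flow_flip ad cv.
  + by rewrite mem_filter => /andP[cv _]; apply: reduction_flow_inj ad cv.
- split=> [j v|j v|i j v].
  + exact: euclid_flow_states ad K3 K0.
  + by rewrite mem_filter => /andP[cv _] _; apply: euclid_flow_flip K0 ad cv.
  + by rewrite mem_filter => /andP[cv _]; apply: euclid_flow_inj ad cv.
Qed.

(** By [deconvolution] both sides may be compared after convolution with theta, at N + 1 = 4 M. The
    squares then give 16 divisor sums of M, and the forms give the number of sinks, which is 4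
    divisor sums. *)
Lemma theta3_formA R N : (N %% 8 = 3)%N -> (3 * N.+1 < R)%N ->
  (square_series oddz R ^+ 3)`_N = 4 * (num_forms formA R N%:Z)%:Z.
Proof.
move=> N8 NR; apply/eqP; rewrite -subr_eq0; apply/eqP; move: N N8 NR.
set th := square_series oddz R.
have gd N x : (N %% 8 == 3)%N -> oddz x -> (absz x ^ 2 <= N.+1)%N ->
  ((N.+1 - absz x ^ 2) %% 8 == 3)%N.
  move=> N8 ox xN; have := odd_sqr_mod8 x (eqP ox); have := sqr_absz x; lia.
move=> N N8; move: {N8} (introT eqP N8).
apply: (deconvolution R (fun N => (N %% 8 == 3)%N) (fun N => (th ^+ 3)`_N - 4
  * (num_forms formA R N%:Z)%:Z)) => //.
move=> {}N gN NR.
have [M [oM EN]] : exists M, odd M /\ N.+1 = (4 * M)%N by exists (N.+1 %/ 4)%N; lia.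
rewrite sumrB -coef_square_series_mul -exprS -mulr_sumr.
rewrite -sum_num_forms; last exact: formA_gt0.
rewrite EN theta4_coef //; last by lia.
rewrite PoszM -count_reduction_sinks_classA //; last by lia.
by rewrite (count_sinks_reduction_euclid _ _ _ (classA_admissible M oM))
  ?count_euclid_sinks_classA ?residuesE //; lia.
Qed.

(** The same at N + 1 = 2 M: the squares give 4 divisor sums, and the forms only 2, since each of
    them comes from two sinks. *)
Lemma theta_phi2_formB R N : (N %% 4 = 1)%N -> (3 * N.+1 < R)%N ->
  (square_series oddz R * square_series evenz R ^+ 2)`_N = 2 * (num_forms formB R N%:Z)%:Z.
Proof.
move=> N4 NR; apply/eqP; rewrite -subr_eq0; apply/eqP; move: N N4 NR.
set th := square_series oddz R; set ph := square_series evenz R.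
have gd N x : (N %% 4 == 1)%N -> oddz x -> (absz x ^ 2 <= N.+1)%N ->
  ((N.+1 - absz x ^ 2) %% 4 == 1)%N.
  move=> N8 ox xN; have := odd_sqr_mod8 x (eqP ox); have := sqr_absz x; lia.
move=> N N4; move: {N4} (introT eqP N4).
apply: (deconvolution R (fun N => (N %% 4 == 1)%N) (fun N => (th * ph ^+ 2)`_N - 2
  * (num_forms formB R N%:Z)%:Z)) => //.
move=> {}N gN NR.
have [M [oM EN]] : exists M, odd M /\ N.+1 = (2 * M)%N by exists (N.+1 %/ 2)%N; lia.
rewrite sumrB -coef_square_series_mul -mulr_sumr.
rewrite -sum_num_forms; last exact: formB_gt0.
rewrite EN (_ : th * (th * ph ^+ 2) = th * ph * (th * ph)); last by ring.
rewrite theta2_phi2_coef //; last by lia.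
have E : (2 * M)%N%:Z = 2 * M%:Z by lia.
have := count_reduction_sinks_classB M R oM;
  rewrite (count_sinks_reduction_euclid _ (2 * M)%N _ (classB_admissible M oM)); [|lia|lia].
rewrite count_euclid_sinks_classB //; last by lia.
have := residuesE M R; rewrite E; move: (\sum_(_ <- _ | _) _)%N => S H1 H2.
have := H1 _ _; have := H2 _; lia.
Qed.

Lemma theta3_neq0 R N : (N %% 8 = 3)%N -> (3 * N.+1 < R)%N -> (square_series oddz R ^+ 3)`_N != 0.
Proof.
move=> N8 NR; rewrite theta3_formA // mulf_neq0 // -lt0n -has_count; apply/hasP.
(* The quotient (N + 1) / 4 is odd because N = 3 mod 8. *)
exists (1, (N.+1 %/ 4)%N%:Z, 1); first by rewrite !mem_box mem_irange; lia.
by rewrite /formA /oddz mul1r expr1n; lia.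
Qed.

Lemma theta_phi2_neq0 R N : (N %% 4 = 1)%N -> (3 * N.+1 < R)%N ->
  (square_series oddz R * square_series evenz R ^+ 2)`_N != 0.
Proof.
move=> N8 NR; rewrite theta_phi2_formB // mulf_neq0 // -lt0n -has_count; apply/hasP.
exists (1, N%:Z, 0); first by rewrite !mem_box mem_irange; lia.
by rewrite /formB /oddz /evenz mul1r expr0n; lia.
Qed.

Lemma coef_square_series3 P1 P2 P3 R n :
  (square_series P1 R * (square_series P2 R * square_series P3 R))`_n != 0 ->
  exists x y z : int, n%:Z = x ^+ 2 + y ^+ 2 + z ^+ 2.
Proof.
case/coef_square_series_neq0 => x [_ xn /coef_square_series_neq0 [y [_ yn]]].
rewrite -[square_series P3 R]mulr1 => /coef_square_series_neq0 [z [_ zn]].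
rewrite coef1 => h; exists x, y, z; rewrite -!sqr_absz.
move: (absz x ^ 2)%N (absz y ^ 2)%N (absz z ^ 2)%N xn yn zn h => u v w ? ? ?.
by case: eqP => // ? _; lia.
Qed.

Lemma three_squares N : (N %% 8 = 3)%N \/ (N %% 4 = 1)%N ->
  exists x y z : int, N%:Z = x ^+ 2 + y ^+ 2 + z ^+ 2.
Proof.
have R0 : (3 * N.+1 < 3 * N.+2)%N by lia.
case=> h; [have := theta3_neq0 _ N h R0|have := theta_phi2_neq0 _ N h R0].
  by rewrite !exprS expr0 mulr1; apply: coef_square_series3.
by rewrite expr2; apply: coef_square_series3.
Qed.

(** * The coefficients modulo 8 *)

(** Truncated to match the bounds in [colored_binary_partitions]. *)
Definition partition_series (n : nat) : {poly int} :=
  \prod_(j < n.+1) \sum_(e < n.+1) 'X^(e * 2 ^ j).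

Lemma b_partition_series m n : (b m n)%:Z = (partition_series n ^+ m)`_n.
Proof.
have -> : partition_series n ^+ m =
    \prod_(p : 'I_n.+1 * 'I_m) \sum_(e < n.+1) 'X^(e * 2 ^ p.1).
  rewrite -(pair_bigA _ (fun (j : 'I_n.+1) (_ : 'I_m) => \sum_(e < n.+1) 'X^(e * 2 ^ j))) /=.
  by rewrite -prodrXl; apply: eq_bigr => j _; rewrite prodr_const card_ord.
rewrite bigA_distr_bigA coef_sum /b -sum1_card -natz natr_sum big_mkcond.
apply: eq_bigr => f _; rewrite inE -(big_morph _ (exprD 'X) (expr0 'X)) coefXn eq_sym.
by case: eqP.
Qed.

(* Congruence modulo the ideal generated by d and X^(n+1). *)
Definition congs (d n : nat) (A B : {poly int}) : Prop :=
  exists U V, A = B + d%:R * U + V * 'X^(n.+1).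

Lemma congs_refl d n A : congs d n A A.
Proof. by exists 0, 0; ring. Qed.

Lemma congs_sym d n A B : congs d n A B -> congs d n B A.
Proof. by case=> U [V ->]; exists (- U), (- V); ring. Qed.

Lemma congs_trans d n A B C : congs d n A B -> congs d n B C -> congs d n A C.
Proof. by case=> U [V ->] [U' [V' ->]]; exists (U + U'), (V + V'); ring. Qed.

Lemma congsM d n A B A' B' : congs d n A B -> congs d n A' B' -> congs d n (A * A') (B * B').
Proof.
case=> U [V ->] [U' [V' ->]].
exists (U * B' + B * U' + d%:R * U * U'), (V * (B' + d%:R * U' + V' * 'X^(n.+1)) + (B
  + d%:R * U) * V'); ring.
Qed.

Lemma congsX d n A B k : congs d n A B -> congs d n (A ^+ k) (B ^+ k).
Proof.
move=> AB; elim: k => [|k IH]; first exact: congs_refl.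
by rewrite !exprS; apply: congsM.
Qed.

Lemma congs_prod d n I (r : seq I) (F G : I -> {poly int}) :
  (forall i, congs d n (F i) (G i)) -> congs d n (\prod_(i <- r) F i) (\prod_(i <- r) G i).
Proof.
move=> FG; elim: r => [|i r IH]; first by rewrite !big_nil; exact: congs_refl.
by rewrite !big_cons; apply: congsM.
Qed.

Lemma congs0 d n A B : congs 0 n A B -> congs d n A B.
Proof. by case=> U [V ->]; exists 0, V; ring. Qed.

Lemma congs_coef d n A B i : congs d n A B -> (i <= n)%N ->
  exists z : int, A`_i = B`_i + d%:Z * z.
Proof.
case=> U [V ->] iN; exists U`_i.
by rewrite !coefD coefMXn ltnS iN addr0 mulr_natl coefMn -mulr_natl natz.
Qed.

Lemma congs_Xn n m A : (n < m)%N -> congs 0 n (1 - 'X^m * A) 1.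
Proof.
by move=> nm; exists 0, (- 'X^(m - n.+1) * A); rewrite -{1}(subnK nm) exprD; ring.
Qed.

(** In (B + 2 U)^4 every term but B^4 is divisible by 8. *)
Lemma congs_pow4 n A B : congs 2 n A B -> congs 8 n (A ^+ 4) (B ^+ 4).
Proof.
case=> U [V ->].
apply: (congs_trans _ _ _ ((B + 2 * U) ^+ 4)).
  by apply: congsX; exists 0, V; ring.
by exists (B ^+ 3 * U + 3 * B ^+ 2 * U ^+ 2 + 4 * B * U ^+ 3 + 2 * U ^+ 4), 0; ring.
Qed.

Definition thue_morse_poly (k : nat) : {poly int} := \prod_(j < k) (1 - 'X^(2 ^ j)).

Lemma partition_thue_morse n : congs 0 n (partition_series n * thue_morse_poly n.+1) 1.
Proof.
rewrite /partition_series /thue_morse_poly -big_split /=.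
apply: (congs_trans _ _ _ (\prod_(j < n.+1) 1)); last by rewrite big1_eq; exact: congs_refl.
apply: congs_prod => j /=.
have -> : (\sum_(e < n.+1) 'X^(e * 2 ^ j)) * (1 - 'X^(2 ^ j)) =
  1 - 'X^(n.+1 * 2 ^ j) * 1 :> {poly int}.
  rewrite mulr1 mulnC exprM -(expr1n _ n.+1) [RHS]subrXX mulrC expr1n; congr (_ * _).
  apply: eq_bigr => e _; rewrite expr1n mul1r mulnC exprM.
  by [].
by apply: congs_Xn; rewrite leq_pmulr // expn_gt0.
Qed.

(** Modulo 2, (1 - Y)^2 = 1 - Y^2, so the extra factor 1 - X makes the product collapse step by
    step. *)
Lemma thue_morse_mod2 n k : congs 2 n ((1 - 'X) * thue_morse_poly k) (1 - 'X^(2 ^ k)).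
Proof.
elim: k => [|k IH]; first by rewrite /thue_morse_poly big_ord0 mulr1; exact: congs_refl.
rewrite /thue_morse_poly big_ord_recr /= mulrA.
apply: (congs_trans _ _ _ ((1 - 'X^(2 ^ k)) * (1 - 'X^(2 ^ k)))).
  by apply: congsM => //; exact: congs_refl.
by exists ('X^(2 ^ k) ^+ 2 - 'X^(2 ^ k)), 0; rewrite expnS mulnC exprM; ring.
Qed.

Lemma onesubX_mod2 n k : congs 2 n ((1 - 'X) ^+ (2 ^ k)) (1 - 'X^(2 ^ k)).
Proof.
elim: k => [|k IH]; first exact: congs_refl.
rewrite expnS mulnC !exprM; apply: (congs_trans _ _ _ ((1 - 'X^(2 ^ k)) ^+ 2));
  first exact: congsX.
by exists ('X^(2 ^ k) ^+ 2 - 'X^(2 ^ k)), 0; ring.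
Qed.

(** Modulo 2 and X^(n+1), both sides are inverses of [thue_morse_poly n.+1]. *)
Lemma partition_mod2 n : congs 2 n (partition_series n) (1 - 'X).
Proof.
have h1 : congs 2 n (partition_series n * ((1 - 'X) * thue_morse_poly n.+1)) (partition_series n).
  rewrite -[X in congs _ _ _ X]mulr1; apply: congsM; first exact: congs_refl.
  apply: (congs_trans _ _ _ _ _ (thue_morse_mod2 n n.+1)).
  rewrite -['X^(_)]mulr1; apply: congs0; apply: congs_Xn.
  by rewrite ltnW // ltn_expl.
apply: (congs_trans _ _ _ _ _ (congs_sym _ _ _ _ h1)).
rewrite mulrCA -[X in congs _ _ _ X]mulr1; apply: congsM; first exact: congs_refl.
by apply: congs0; exact: partition_thue_morse.
Qed.

(** Trading one inverse factor for [thue_morse_poly n.+1] raises the exponent to 4 * 2^k; the power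
    2^k is known modulo 2, hence its fourth power modulo 8. *)
Lemma partition_mod8 n k : congs 8 n (partition_series n ^+ (2 ^ k.+2 - 1))
  ((1 - 'X^(2 ^ k)) ^+ 4 * thue_morse_poly n.+1).
Proof.
set P := partition_series n; set D := thue_morse_poly n.+1.
apply: (congs_trans _ _ _ (P ^+ (2 ^ k * 4) * D)).
  apply: congs_sym; have -> : (2 ^ k * 4 = (2 ^ k.+2 - 1).+1)%N by have := expn_gt0 2 k;
    rewrite !expnS; lia.
  rewrite exprSr -mulrA -[X in congs _ _ _ X]mulr1; apply: congsM; first exact: congs_refl.
  by apply: congs0; exact: partition_thue_morse.
apply: congsM; last exact: congs_refl.
rewrite exprM; apply: congs_pow4; apply: (congs_trans _ _ _ ((1 - 'X) ^+ (2 ^ k))).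
  by apply: congsX; exact: partition_mod2.
exact: onesubX_mod2.
Qed.

Lemma s2_bound n N : (n < 2 ^ N)%N -> s2 n = (\sum_(i < N) (n %/ 2 ^ i) %% 2)%N.
Proof.
have H M d : (n < 2 ^ M)%N -> (\sum_(i < M + d) (n %/ 2 ^ i) %% 2 =
  \sum_(i < M) (n %/ 2 ^ i) %% 2)%N.
  move=> nM; rewrite big_split_ord /= [X in (_ + X)%N]big1 ?addn0 // => i _.
  by rewrite divn_small // (leq_trans nM) // leq_exp2l // leq_addr.
move=> nN; rewrite /s2 -(H n N (ltn_expl n (ltnSn 1))) addnC; exact: H.
Qed.

Lemma t_pow2D k i : (i < 2 ^ k)%N -> t (2 ^ k + i) = - t i.
Proof.
move=> ik; rewrite /t (s2_bound i k) // (s2_bound (2 ^ k + i) k.+1); last by rewrite expnS; lia.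
rewrite big_ord_recr /= divnDl // divnn expn_gt0 /= divn_small // addn0 addn1 exprS mulN1r.
(* The lower digits do not change: for j < k, 2^k adds an even number to the quotient by 2^j. *)
congr (- _ ^+ _); apply: eq_bigr => -[j /= jk] _.
have [d ->] : exists d, k = (j + d.+1)%N by exists (k - j).-1; lia.
by rewrite expnD divnDl ?dvdn_mulr // mulKn ?expn_gt0 // expnS mulnC modnMDl.
Qed.

Lemma t_sign n : t n = 1 \/ t n = -1.
Proof. by rewrite /t -signr_odd; case: odd; [right|left]. Qed.

(** Multiplying by 1 - X^(2^k) adds the binary digit of index k, with the sign given by
    [t_pow2D]. *)
Lemma coef_thue_morse k i : (thue_morse_poly k)`_i = if (i < 2 ^ k)%N then t i else 0.
Proof.
elim: k i => [|k IH] i.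
  rewrite /thue_morse_poly big_ord0 coef1; case: i => [|i] //=.
  by rewrite /t /s2 big_ord0.
rewrite /thue_morse_poly big_ord_recr /= mulrBr mulr1 coefB coefMXn -/(thue_morse_poly k) !IH.
rewrite expnS; case: (ltnP i (2 ^ k)) => ik.
  by rewrite subr0 ifT //; lia.
rewrite sub0r; have -> : (i - 2 ^ k < 2 ^ k)%N = (i < 2 * 2 ^ k)%N by lia.
case: ifP => i2; last by rewrite oppr0.
by rewrite -(t_pow2D k) ?subnKC //; lia.
Qed.

Lemma b_mod8 k n (q := (2 ^ k)%N) : exists z : int, (b (4 * q - 1) n)%:Z =
  t n - 4 * (if (q <= n)%N then t (n - q) else 0)
    + 6 * (if (2 * q <= n)%N then t (n - 2 * q) else 0)
  - 4 * (if (3 * q <= n)%N then t (n - 3 * q) else 0)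
    + (if (4 * q <= n)%N then t (n - 4 * q) else 0) + 8 * z.
Proof.
rewrite b_partition_series; have -> : (4 * q - 1 = 2 ^ k.+2 - 1)%N by rewrite /q !expnS mulnA.
have [z ->] := congs_coef _ _ _ _ n (partition_mod8 n k) (leqnn n).
exists z; congr (_ + _); rewrite -/q.
have D i : (thue_morse_poly n.+1)`_i = if (i < 2 ^ n.+1)%N then t i else 0
  by exact: coef_thue_morse.
have nn : (n < 2 ^ n.+1)%N by rewrite ltnW // ltn_expl.
have -> : (1 - 'X^q) ^+ 4 * thue_morse_poly n.+1 =
  thue_morse_poly n.+1 - 4 * (thue_morse_poly n.+1 * 'X^q)
   + 6 * (thue_morse_poly n.+1 * 'X^(2 * q)) - 4 * (thue_morse_poly n.+1 * 'X^(3 * q))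
     + thue_morse_poly n.+1 * 'X^(4 * q) :> {poly int}.
  by rewrite !(mulnC _ q) !exprM; ring.
have M (c : nat) (p : {poly int}) : (c%:R * p)`_n = c%:R * p`_n by rewrite !mulr_natl coefMn.
rewrite !coefD !coefN !M !coefMXn !D nn.
have small j : (n - j < 2 ^ n.+1)%N by lia.
by rewrite !small; case: (leqP q n); case: (leqP (2 * q) n); case: (leqP (3 * q) n);
  case: (leqP (4 * q) n).
Qed.

Lemma sum_of_three_squares_mod8 (N : int) : (N %% 8 = 7)%Z -> ~ sum_of_three_squares N.
Proof.
move=> N7 [x [y [z E]]].
have sq (u : int) : (u ^+ 2 %% 8 = 1)%Z \/ (u ^+ 2 %% 4 = 0)%Z.
  have [o|e] : (u %% 2 = 1)%Z \/ (u %% 2 = 0)%Z by lia.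
    by left; apply: odd_sqr_mod8.
  by right; apply: even_sqr_mod4.
have := sq x; have := sq y; have := sq z; lia.
Qed.

Lemma sum_of_three_squares_odd (N : nat) :
  odd N -> ~ sum_of_three_squares N%:Z <-> (N %% 8 = 7)%N.
Proof.
move=> oN; split=> [h|N7]; last by apply: sum_of_three_squares_mod8; lia.
apply/eqP; apply/negPn/negP => N7; apply: h.
by apply: three_squares; lia.
Qed.

Theorem corollary5p3 (k n : nat) (hk : (3 <= k)%N) (hn : (n < 2 ^ k)%N) :
  ~ sum_of_three_squares (b (2 ^ k - 1)%N n)%:Z <->
    ((0 <= n < 2 ^ (k - 2))%N /\ t n = -1) \/
    ((2 ^ (k - 1) <= n < 3 * 2 ^ (k - 2))%N /\ t n = 1).
Proof.
have [j Ek] : exists j, k = j.+3 by exists (k - 3)%N; lia.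
have Ek2 : (k - 2 = j.+1)%N by lia.
have Ek1 : (k - 1 = j.+2)%N by lia.
have E4 : (2 ^ k = 4 * 2 ^ j.+1)%N by rewrite Ek !expnS; lia.
have E2 : (2 ^ j.+2 = 2 * 2 ^ j.+1)%N by rewrite expnS.
rewrite Ek2 Ek1 E2 E4; rewrite E4 in hn.
have top : (2 * 2 ^ j.+1 <= n)%N -> t n = - t (n - 2 * 2 ^ j.+1).
  by move=> h; rewrite -{1}(subnKC h) -E2 t_pow2D //; lia.
have [z] := b_mod8 j.+1 n; move: top hn.
set q := (2 ^ j.+1)%N; set B := b _ n => top hn HB.
have T0 := t_sign n; have T1 := t_sign (n - q); have T2 := t_sign (n - 2 * q);
  have T3 := t_sign (n - 3 * q).
have oB : odd B by move: HB; do 4![case: ifP => ?]; lia.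
rewrite sum_of_three_squares_odd //.
(* On the four successive intervals of length q, [B] is t, t + 4, - 5 t + 4 and - 5 t modulo 8,
   where t stands for [t n]. This is 7 for t = -1 on the first, for t = 1 on the third, and never on
   the other two. *)
move: HB top; do 4![case: ifP => ?]; lia.
Qed.
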